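(* Let $\mathcal{A}$ be a weakly irreducible nonnegative tensor of order $k$ and dimension $n$ with spectral radius $\rho(\mathcal{A})$, and let $\lambda$ be any eigenvalue of $\mathcal{A}$ with $|\lambda|=\rho(\mathcal{A})$. Then $$\mathrm{am}(\lambda)\ge |\mathbb{V}_\lambda(\mathcal{A})|,$$ where $|\mathbb{V}_\lambda(\mathcal{A})|$ is the number of points of the projective eigenvariety of $\mathcal{A}$ associated with $\lambda$. Moreover, the Hu-Ye Conjecture holds for the eigenvalue $\lambda$ of $\mathcal{A}$, i.e., if $V_1,\ldots,V_\kappa$ are all the irreducible components of the affine eigenvariety $\mathcal{V}_\lambda(\mathcal{A})$, then $$\mathrm{am}(\lambda)\ge\sum_{i=1}^{\kappa}\dim(V_i)(k-1)^{\dim(V_i)-1},$$ and in particular $\mathrm{am}(\lambda)\ge \mathrm{gm}(\lambda)(k-1)^{\mathrm{gm}(\lambda)-1}$.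
   Context: Let $[n]=\{1,\ldots,n\}$. A tensor $\mathcal{A}=(a_{i_1\ldots i_k})$ of order $k\ge 2$ and dimension $n$ is an array of entries $a_{i_1\ldots i_k}\in\mathbb{C}$, $i_1,\ldots,i_k\in[n]$. It is nonnegative if all entries are nonnegative reals. For $x\in\mathbb{C}^n$, $\mathcal{A}x^{k-1}\in\mathbb{C}^n$ is given by $(\mathcal{A}x^{k-1})_i=\sum_{i_2,\ldots,i_k\in[n]}a_{ii_2\ldots i_k}x_{i_2}\cdots x_{i_k}$, and $x^{[k-1]}=(x_1^{k-1},\ldots,x_n^{k-1})$. A number $\lambda\in\mathbb{C}$ is an eigenvalue of $\mathcal{A}$ if $\mathcal{A}x^{k-1}=\lambda x^{[k-1]}$ for some $x\in\mathbb{C}^n\setminus\{0\}$ (an eigenvector). The characteristic polynomial $\varphi_{\mathcal{A}}(\lambda)$ is the (multivariate homogeneous) resultant $\mathrm{Res}(F_1,\ldots,F_n)$ of the $n$ homogeneous polynomials $F_i=\lambda x_i^{k-1}-(\mathcal{A}x^{k-1})_i$ of degree $k-1$ in $x_1,\ldots,x_n$; its roots are exactly the eigenvalues of $\mathcal{A}$. The algebraic multiplicity $\mathrm{am}(\lambda)$ is the multiplicity of $\lambda$ as a root of $\varphi_{\mathcal{A}}$. The spectral radius $\rho(\mathcal{A})$ is the largest modulus of the roots of $\varphi_{\mathcal{A}}$. The affine eigenvariety is $\mathcal{V}_\lambda(\mathcal{A})=\{x\in\mathbb{C}^n:\mathcal{A}x^{k-1}=\lambda x^{[k-1]}\}$;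 the geometric multiplicity $\mathrm{gm}(\lambda)$ is the dimension of $\mathcal{V}_\lambda(\mathcal{A})$ (the maximum dimension of its irreducible components). The projective eigenvariety is $\mathbb{V}_\lambda(\mathcal{A})=\{x\in\mathbb{P}^{n-1}:\mathcal{A}x^{k-1}=\lambda x^{[k-1]}\}$, where $\mathbb{P}^{n-1}$ is complex projective space. The directed graph $D(\mathcal{A})$ has vertices $1,\ldots,n$ and an arc $(i,j)$ if and only if there is a nonzero entry $a_{ii_2\ldots i_k}$ with $j\in\{i_2,\ldots,i_k\}$. The tensor $\mathcal{A}$ is weakly irreducible if $D(\mathcal{A})$ is strongly connected. *)

(* Defs.v *)
From HB Require Import structures.
From mathcomp Require Import all_boot all_order all_algebra.
From mathcomp Require Import boolp classical_sets functions cardinality reals.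
From mathcomp Require Import complex mpoly.

Set Implicit Arguments.
Unset Strict Implicit.
Unset Printing Implicit Defensive.

Import Order.TTheory GRing.Theory Num.Theory.

Local Open Scope classical_set_scope.
Local Open Scope ring_scope.

(* The entry a_{i i_2 ... i_k} of [A : tensor T k n] is [A i t] with
   t = (i_2, ..., i_k); this is a k-dimensional array as soon as k >= 1. *)
Definition tensor (T : Type) (k n : nat) : Type :=
  'I_n -> (k.-1).-tuple 'I_n -> T.

Section Resultant.
Variables n d : nat.

Definition homog_monom : finType :=
  {m : 'X_{1..n < d.+1} | mdeg (bmnm m) == d}.

(* The generic coefficients u_{i, m}: the coefficient of the monomial m (of
   degree d) in the i-th of n forms of degree d in n variables. *)
Definition coef_index : finType := ('I_n * homog_monom)%type.

Definition generic_coef_poly : Type := {mpoly int[#|coef_index|]}.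

Definition eval_coef (S : comNzRingType) (Res : generic_coef_poly)
    (F : 'I_n -> {mpoly S[n]}) : S :=
  (map_mpoly (intr : int -> S) Res).@[
     fun j => let u := enum_val j in (F u.1)@_(bmnm (val u.2))].

(* The multivariate resultant of n forms of degree d in n variables is the
   unique integer polynomial in the generic coefficients with these three
   properties (Cox, Little and O'Shea, Using Algebraic Geometry, Ch. 3,
   Theorem 2.3). *)
Definition is_resultant (C : numClosedFieldType) (Res : generic_coef_poly) : Prop :=
  [/\ forall F : 'I_n -> {mpoly C[n]}, (forall i, F i \is d.-homog) ->
        (eval_coef Res F = 0 <->
         exists2 x : 'rV[C]_n, x != 0 & forall i, (F i).@[x 0] = 0),
      eval_coef Res (fun i => 'X_i ^+ d : {mpoly C[n]}) = 1
    & let ResC := map_mpoly (intr : int -> C) Res in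
      [/\ ResC != 0, ResC \isn't a GRing.unit
        & forall P Q : {mpoly C[#|coef_index|]}, ResC = P * Q ->
            P \is a GRing.unit \/ Q \is a GRing.unit]].

End Resultant.

Section Zariski.
Variables (C : numClosedFieldType) (n : nat).
Implicit Types V W Z : set 'rV[C]_n.

Definition zariski_closed V : Prop :=
  exists S : set {mpoly C[n]}, V = [set x | forall p, S p -> p.@[x 0] = 0].

Definition irreducible_closed V : Prop :=
  [/\ zariski_closed V, V !=set0
    & forall W Z, zariski_closed W -> zariski_closed Z ->
        V `<=` W `|` Z -> V `<=` W \/ V `<=` Z].

Definition irreducible_component V W : Prop :=
  [/\ irreducible_closed W, W `<=` V
    & forall Z, irreducible_closed Z -> Z `<=` V -> W `<=` Z -> Z = W].

(* There is a chain Z_0 < Z_1 < ... < Z_d of irreducible closed subsets of V. *)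
Definition has_chain V (d : nat) : Prop :=
  exists Z : nat -> set 'rV[C]_n,
    (forall i, (i <= d)%N -> irreducible_closed (Z i) /\ Z i `<=` V) /\
    (forall i, (i < d)%N -> Z i `<` Z i.+1).

(* Krull dimension. The maximum exists for every nonempty closed V, being at
   most n; the default value 0 is only reached when there is no chain. *)
Definition zdim V : nat :=
  xget 0%N [set d | has_chain V d /\ forall e, has_chain V e -> (e <= d)%N].

End Zariski.

Section Tensor.
Variables (C : numClosedFieldType) (k n : nat).
Implicit Types (A : tensor C k n) (x : 'rV[C]_n) (lambda : C).

Definition nonneg_tensor A : Prop := forall i t, 0 <= A i t.

Definition tensor_app A x : 'rV[C]_n :=
  \row_i \sum_(t : (k.-1).-tuple 'I_n) A i t * \prod_(j <- t) x 0 j.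

Definition hadamard_pow x (m : nat) : 'rV[C]_n := \row_i x 0 i ^+ m.

Definition affine_eigenvariety A lambda : set 'rV[C]_n :=
  [set x | tensor_app A x = lambda *: hadamard_pow x k.-1].

Definition eigenvalue_of A lambda : Prop :=
  exists2 x, x != 0 & affine_eigenvariety A lambda x.

Definition projective_space : set {vspace 'rV[C]_n} :=
  [set L | \dim L = 1%N].

(* The equations are homogeneous, so a point of projective space satisfies
   them when the line it represents lies in the affine eigenvariety. *)
Definition projective_eigenvariety A lambda : set {vspace 'rV[C]_n} :=
  [set L | projective_space L /\
           forall x, x \in L -> affine_eigenvariety A lambda x].

Definition tensor_digraph A : rel 'I_n :=
  fun i j => [exists t : (k.-1).-tuple 'I_n, (A i t != 0) && (j \in t)].

Definition weakly_irreducible A : Prop :=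
  forall i j, connect (tensor_digraph A) i j.

(* The form lambda x_i^(k-1) - (A x^(k-1))_i, with lambda the variable of
   {poly C}. *)
Definition char_form A (i : 'I_n) : {mpoly {poly C}[n]} :=
  ('X : {poly C}) *: 'X_i ^+ k.-1 -
  \sum_(t : (k.-1).-tuple 'I_n) (A i t)%:P *: \prod_(j <- t) 'X_j.

Definition tensor_char_poly (Res : generic_coef_poly n k.-1) A : {poly C} :=
  eval_coef Res (char_form A).

Definition alg_mult (Res : generic_coef_poly n k.-1) A lambda : nat :=
  mup lambda (tensor_char_poly Res A).

Definition geom_mult A lambda : nat := zdim (affine_eigenvariety A lambda).

Definition is_spectral_radius (Res : generic_coef_poly n k.-1) A (rho : C) : Prop :=
  (exists2 z, root (tensor_char_poly Res A) z & `|z| = rho) /\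
  (forall z, root (tensor_char_poly Res A) z -> `|z| <= rho).

End Tensor.

(* Main.v *)
Require Import Defs.
From mathcomp Require Import all_boot all_order all_algebra.
From mathcomp Require Import boolp classical_sets functions cardinality reals.
From mathcomp Require Import complex mpoly ring lra.

(* By a nonlinear Perron-Frobenius argument, the eigenvectors x of modulus rho
   all have |x| proportional to the positive Perron vector, and their phases
   make every nonzero term a_(i,t) x^t a nonnegative multiple of
   lambda x_i^(k-1); the maximum principle then shows that the Jacobian at x of
   the system F_lambda = lambda x^[k-1] - A x^(k-1) has kernel spanned by x.
   Hence the systems G for which F_lambda + e G has, to first order in e, a zero
   near x form a hyperplane H_x, and distinct points x of the projective
   eigenvariety give distinct hyperplanes. The lowest homogeneous part of
   G |-> Res(F_lambda + G) vanishes on every H_x, so its degree, which is at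
   most am(lambda), is at least the number of points. In particular this number
   is finite, so the affine eigenvariety is a finite union of lines, its
   irreducible components are these lines, and all dimensions are 1. *)

Set Implicit Arguments.
Unset Strict Implicit.
Unset Printing Implicit Defensive.

Import Order.TTheory GRing.Theory Num.Theory.

Local Open Scope classical_set_scope.
Local Open Scope ring_scope.

(** * A nonlinear Perron theorem *)

(** Bernoulli's inequality replaces the continuity of the power at 1. Dividing by [d.+2] makes the
    bound strict and keeps [e] below 1 even when [d] is 0. *)
Lemma exists_expr_gt (R : realFieldType) (d : nat) (al : R) : al < 1 ->
  exists q : R, [/\ 0 < q, q < 1 & al < q ^+ d].
Proof.
move=> al1.
have bernoulli (e : R) m : 0 <= e <= 1 -> 1 - m%:R * e <= (1 - e) ^+ m.
  move=> /andP[e0 e1]; elim: m => [|m IH]; first by rewrite mul0r subr0 expr0.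
  rewrite exprS; apply: (@le_trans _ _ ((1 - e) * (1 - m%:R * e))).
    have : 0 <= m%:R * (e * e) by rewrite !mulr_ge0.
    by rewrite -natr1; nra.
  by rewrite ler_wpM2l // subr_ge0.
pose b := Num.max al 0; pose e := (1 - b) / d.+2%:R.
have d0 : 0 < d.+2%:R :> R by rewrite ltr0n.
have b1 : b < 1 by rewrite gt_max al1 ltr01.
have b0 : 0 <= b by rewrite le_max lexx orbT.
have alb : al <= b by rewrite le_max lexx.
have e0 : 0 < e by rewrite divr_gt0 // subr_gt0.
have ed : e * d.+2%:R = 1 - b by rewrite divfK // gt_eqF.
have ed' : e * d%:R + e *+ 2 = 1 - b by rewrite -ed -!natr1; ring.
have de0 : 0 <= e * d%:R by rewrite mulr_ge0 // ltW.
exists (1 - e); split; [lra|lra|].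
apply: (lt_le_trans _ (bernoulli e d _)); last by apply/andP; split; lra.
by rewrite mulrC; lra.
Qed.

(** Take [q < 1] with [r * x ^+ d / s < q ^+ d] and replace [x] by [x / q]. *)
Lemma expr_lt_enlarge (R : realFieldType) (d : nat) (x r s : R) :
  0 < x -> 0 <= r -> r * x ^+ d < s -> exists c, x < c /\ r * c ^+ d < s.
Proof.
move=> x0 r0 lt_s.
have s0 : 0 < s by apply: le_lt_trans lt_s; rewrite mulr_ge0 // exprn_ge0 // ltW.
have [|q [q0 q1 hq]] := @exists_expr_gt R d (r * x ^+ d / s).
  by rewrite ltr_pdivrMr // mul1r.
exists (x / q); rewrite ltr_pdivlMr // gtr_pMr //; split=> //.
by rewrite expr_div_n mulrA ltr_pdivrMr ?exprn_gt0 // [ltRHS]mulrC -ltr_pdivrMr.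
Qed.

Lemma ltr_prod_seq (R : numDomainType) (I : eqType) (s : seq I) (u v : I -> R)
    (j : I) :
  (forall i, 0 <= u i <= v i) -> (forall i, 0 < v i) -> j \in s -> u j < v j ->
  \prod_(i <- s) u i < \prod_(i <- s) v i.
Proof.
move=> uv v0 js uj; elim: s js => [//|a s IH].
rewrite inE !big_cons => jas; have [u0 ua] := andP (uv a).
have P0 : 0 < \prod_(i <- s) v i by apply: prodr_gt0.
have U0 : 0 <= \prod_(i <- s) u i by apply: prodr_ge0 => i _; case/andP: (uv i).
case/orP: jas => [/eqP ja|jins].
  apply: (@le_lt_trans _ _ (u a * \prod_(i <- s) v i)).
    by apply: ler_wpM2l => //; apply: ler_prod.
  by rewrite ltr_pM2r // -ja.
apply: (@le_lt_trans _ _ (v a * \prod_(i <- s) u i)); first exact: ler_wpM2r.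
by rewrite ltr_pM2l //; apply: IH.
Qed.

Section PerronFrobenius.
Variables (R : realType) (n d : nat) (a : 'I_n -> d.-tuple 'I_n -> R).
Hypothesis a_ge0 : forall i t, 0 <= a i t.
Implicit Types (u v : 'I_n -> R) (r B : R).

Definition form_app v i : R := \sum_t a i t * \prod_(j <- t) v j.

Definition form_arc : rel 'I_n :=
  fun i j => [exists t : d.-tuple 'I_n, (a i t != 0) && (j \in t)].

Hypothesis a_irr : forall i j, connect form_arc i j.

Lemma form_app_ge0 v i : (forall j, 0 <= v j) -> 0 <= form_app v i.
Proof. by move=> v0; apply: sumr_ge0 => t _; rewrite mulr_ge0 // prodr_ge0. Qed.

Lemma form_app_le u v i : (forall j, 0 <= u j <= v j) ->
  form_app u i <= form_app v i.
Proof. by move=> uv; apply: ler_sum => t _; rewrite ler_wpM2l // ler_prod. Qed.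

Lemma form_appZ c v i : form_app (fun j => c * v j) i = c ^+ d * form_app v i.
Proof.
rewrite mulr_sumr; apply: eq_bigr => t _; rewrite big_split /=.
by rewrite big_const_seq count_predT size_tuple iter_mulr_1 mulrCA.
Qed.

Lemma form_app_lt u v i j : (forall l, 0 <= u l <= v l) -> (forall l, 0 < v l) ->
  form_arc i j -> u j < v j -> form_app u i < form_app v i.
Proof.
move=> uv v0 /existsP[t /andP[at0 jt]] uj.
rewrite /form_app (bigD1 t) //= [ltRHS](bigD1 t) //=; apply: ltr_leD.
  by rewrite ltr_pM2l ?(ltr_prod_seq uv v0 jt) // lt_def at0 a_ge0.
by apply: ler_sum => s _; rewrite ler_wpM2l // ler_prod.
Qed.

(** By homogeneity every positive subsolution rescales to one with entries at least 1. This
    normalization keeps infima positive and bounds every monomial below by 1. *)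
Definition subsol r : set ('I_n -> R) :=
  [set v | (forall i, 1 <= v i) /\ forall i, form_app v i <= r * v i ^+ d].

(** Along an arc from [i] to [j], some term of row [i] contains [v j]. Its other factors are at
    least 1, so [a i t * v j] is at most [B * v i ^+ d], and a bound on [v i] yields one on
    [v j]. *)
Lemma subsol_bound_path B i p : path form_arc i p -> forall b,
  exists K, forall v, subsol B v -> v i <= b -> v (last i p) <= K.
Proof.
elim: p i => [|j p IH] i /=; first by move=> _ b; exists b.
move=> /andP[/existsP[t /andP[at0 jt]] jp] b.
have [K hK] := IH j jp (`|B| * b ^+ d / a i t).
exists K => v hv vib; apply: hK => //; case: hv => v1 hv.
have at_gt : 0 < a i t by rewrite lt_def at0 a_ge0.
have v0 l : 0 <= v l by apply: le_trans (v1 l).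
rewrite ler_pdivlMr //; apply: (@le_trans _ _ (form_app v i)); last first.
  apply: (le_trans (hv i)); apply: (@le_trans _ _ (`|B| * v i ^+ d)).
    by rewrite ler_wpM2r ?exprn_ge0 // ler_norm.
  by rewrite ler_wpM2l // lerXn2r // nnegrE // (le_trans (v0 i)).
rewrite /form_app (bigD1 t) //= mulrC -[leLHS]addr0; apply: lerD; last first.
  by apply: sumr_ge0 => s _; rewrite mulr_ge0 // prodr_ge0.
rewrite ler_wpM2l // (perm_big _ (perm_to_rem jt)) /= big_cons.
rewrite ler_peMr //; elim/big_rec: _ => // l x _ x1; exact: mulr_ege1.
Qed.

Lemma subsol_bound B : exists K, forall v i, subsol B v -> v i <= 1 ->
  forall j, v j <= K.
Proof.
have /choice[K hK] : forall ij : 'I_n * 'I_n, exists K, forall v,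
    subsol B v -> v ij.1 <= 1 -> v ij.2 <= K.
  by move=> [i j]; have /connectP[p ip ->] := a_irr i j; apply: subsol_bound_path.
exists (\sum_ij `|K ij|) => v i hv vi j; apply: (le_trans (hK (i, j) v hv vi)).
apply: (le_trans (ler_norm _)).
by rewrite (bigD1 (i, j)) //= lerDl sumr_ge0.
Qed.

Definition least_subsol r i : R := inf [set v i | v in subsol r].

Lemma least_subsol_le r v i : subsol r v -> least_subsol r i <= v i.
Proof.
move=> hv; apply: ge_inf; last by exists v.
by exists 1 => _ [w [w1 _] <-].
Qed.

Lemma le_least_subsol r i c : subsol r !=set0 ->
  (forall v, subsol r v -> c <= v i) -> c <= least_subsol r i.
Proof.
move=> [v hv] hc; apply: lb_le_inf; first by exists (v i), v.
by move=> _ [w hw <-]; apply: hc.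
Qed.

Lemma subsol_ge0 r : (0 < n)%N -> subsol r !=set0 -> 0 <= r.
Proof.
move=> n0 [v [v1 hv]]; have := hv (Ordinal n0).
have v0 l : 0 < v l by apply: lt_le_trans (v1 l).
move/(le_trans (form_app_ge0 _ (fun j => ltW (v0 j)))).
by rewrite pmulr_lge0 // exprn_gt0.
Qed.

(** If row [i] failed for the infimum [u], it would still fail with [u i] enlarged to some [c]. A
    subsolution [v] with [v i < c] contradicts this, since [form_app] is monotone and [u <= v]. *)
Lemma least_subsolP r : (0 < n)%N -> subsol r !=set0 -> subsol r (least_subsol r).
Proof.
move=> n0 ne; have r0 := subsol_ge0 n0 ne; split=> i.
  by apply: le_least_subsol => // v [].
have u1 j : 1 <= least_subsol r j by apply: le_least_subsol => // v [].
have u0 j : 0 <= least_subsol r j by apply: le_trans (u1 j).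
rewrite leNgt; apply/negP => lt_ru.
have [c [uc hc]] := expr_lt_enlarge (lt_le_trans ltr01 (u1 i)) r0 lt_ru.
have [v hv vc] : exists2 v, subsol r v & v i < c.
  have [|_ [v hv <-] vc] := @inf_lt _ [set v i | v in subsol r] c _ uc.
    by case: ne => v hv; exists (v i), v.
  by exists v.
suff : form_app (least_subsol r) i < form_app (least_subsol r) i by rewrite ltxx.
apply: le_lt_trans hc; apply: (@le_trans _ _ (form_app v i)).
  by apply: form_app_le => j; rewrite u0 least_subsol_le.
case: hv => v1 hv; apply: (le_trans (hv i)); rewrite ler_wpM2l //.
have c0 := le_trans (u0 i) (ltW uc).
by rewrite lerXn2r ?nnegrE ?(le_trans ler01 (v1 i)) // ltW.
Qed.

Lemma subsol_mono r B : (0 <= r <= B) -> subsol r `<=` subsol B.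
Proof.
move=> /andP[r0 rB] v [v1 hv]; split=> // i; apply: (le_trans (hv i)).
by rewrite ler_wpM2r // exprn_ge0 // (le_trans _ (v1 i)).
Qed.

Lemma subsol_scale r c v : 0 < c -> (forall i, c <= v i) ->
  (forall i, form_app v i <= r * v i ^+ d) -> subsol r (fun i => c^-1 * v i).
Proof.
move=> c0 cv hv; split=> i; first by rewrite mulrC ler_pdivlMr // mul1r.
by rewrite form_appZ exprMn mulrCA ler_wpM2l // exprn_ge0 // invr_ge0 ltW.
Qed.

(** Dividing the least subsolution by its smallest entry gives another subsolution, which cannot be
    smaller. *)
Lemma least_subsol_min r : (0 < n)%N -> subsol r !=set0 ->
  exists i, least_subsol r i <= 1.
Proof.
move=> n0 ne; have [u1 hu] := least_subsolP n0 ne; set u := least_subsol r in u1 hu *.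
pose i0 := [arg min_(i < Ordinal n0) u i]%O.
have u_min i : u i0 <= u i by rewrite /i0; case: arg_minP => // j _; apply.
have c0 : 0 < u i0 by apply: lt_le_trans (u1 i0).
exists i0; have := least_subsol_le i0 (subsol_scale c0 u_min hu).
by rewrite -/u mulVf // gt_eqF.
Qed.

Lemma subsol_exists : exists r, subsol r !=set0.
Proof.
exists (\sum_i form_app (fun=> 1) i), (fun=> 1); split=> // i.
rewrite expr1n mulr1 (bigD1 i) //= lerDl sumr_ge0 // => j _.
exact: form_app_ge0.
Qed.

(** The Collatz-Wielandt value: the infimum over positive [v] of the maximum over [i] of
    [form_app v i / v i ^+ d]. *)
Definition subsol_inf : R := inf [set r | subsol r !=set0].

Lemma subsol_inf_le r : (0 < n)%N -> subsol r !=set0 -> subsol_inf <= r.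
Proof. by move=> n0 hr; apply: ge_inf => //; exists 0 => s; apply: subsol_ge0. Qed.

Lemma subsol_inf_lt r : (0 < n)%N -> subsol_inf < r -> subsol r !=set0.
Proof.
move=> n0 hr; have [|s [v hv] sr] := @inf_lt _ [set r | subsol r !=set0] r _ hr.
  exact: subsol_exists.
exists v; apply: (subsol_mono _ hv); rewrite (ltW sr) andbT.
by apply: subsol_ge0 => //; exists v.
Qed.

(* Subsolutions v >= 1 at level r are stable under pointwise infimum, so there is
   a least one; it grows as r decreases and stays bounded because it takes the
   value 1, so its supremum is a subsolution at the infimal level. *)
Lemma subsol_inf_attained : (0 < n)%N -> subsol subsol_inf !=set0.
Proof.
move=> n0; set r := subsol_inf.
have r_ge0 : 0 <= r.
  apply: lb_le_inf; first exact: subsol_exists.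
  by move=> s; apply: subsol_ge0.
have [K hK] := subsol_bound (r + 1).
pose E i := [set least_subsol s i | s in [set s | r < s <= r + 1]].
have neS s : r < s <= r + 1 -> subsol s !=set0.
  by case/andP=> rs _; apply: subsol_inf_lt.
have ubK s i : r < s <= r + 1 -> least_subsol s i <= K.
  move=> hs; have [j uj] := least_subsol_min n0 (neS s hs).
  apply: hK uj i; apply: subsol_mono (least_subsolP n0 (neS s hs)).
  by case/andP: hs => rs ->; rewrite andbT (le_trans r_ge0) // ltW.
have r1 : r < r + 1 <= r + 1 by rewrite ltrDl lexx ltr01.
have supE i : has_sup (E i).
  split; first by exists (least_subsol (r + 1) i), (r + 1).
  by exists K => _ [s hs <-]; apply: ubK.
pose u i := sup (E i).
have u_ub s i : r < s <= r + 1 -> least_subsol s i <= u i.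
  by move=> hs; apply: ub_le_sup; [case: (supE i)|exists s].
have u1 i : 1 <= u i.
  apply: le_trans (u_ub _ i r1); exact: (least_subsolP n0 (neS _ r1)).1.
have u0 i : 0 < u i by apply: lt_le_trans (u1 i).
exists u; split=> // i; rewrite leNgt; apply/negP => lt_ru.
set S := form_app u i in lt_ru.
have S0 : 0 < S by apply: le_lt_trans lt_ru; rewrite mulr_ge0 // exprn_ge0 // ltW.
(* Shrinking [u] by a factor [q] close to 1 keeps its form at row [i] above [r * u i ^+ d], while
   [q * u] lies below the least subsolution at every level close enough to [r]. *)
have [q [q0 q1 hq]] : exists q : R, [/\ 0 < q, q < 1 & r * u i ^+ d / S < q ^+ d].
  by apply: exists_expr_gt; rewrite ltr_pdivrMr ?mul1r.
have /choice[s hs] : forall j, exists s, r < s <= r + 1 /\ q * u j < least_subsol s j.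
  move=> j; have [_ [s hs <-] qs] : exists2 x, E j x & q * u j < x.
    by apply: sup_gt; [case: (supE j)|rewrite gtr_pMl].
  by exists s.
pose s0 := \big[Order.min/r + 1]_j s j.
have s0r : r < s0 <= r + 1.
  apply/andP; split; last exact: bigmin_le_id.
  by apply/bigmin_gtP; split=> [|j _]; rewrite ?ltrDl //; case: (hs j) => /andP[].
have s0j j : s0 <= s j by apply: bigmin_le_cond.
have least_mono s1 s2 j : r < s1 <= s2 -> s2 <= r + 1 ->
    least_subsol s2 j <= least_subsol s1 j.
  move=> /andP[rs1 s12] s2r; apply: least_subsol_le.
  apply: (@subsol_mono s1); first by rewrite s12 (le_trans r_ge0 (ltW rs1)).
  by apply: least_subsolP => //; apply: subsol_inf_lt.
have key s1 : r < s1 -> s1 <= s0 -> q ^+ d * S <= s1 * u i ^+ d.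
  move=> rs1 s10; have s1r : s1 <= r + 1 by case/andP: s0r => _; apply: le_trans.
  have s1P : r < s1 <= r + 1 by rewrite rs1.
  rewrite -form_appZ; apply: (@le_trans _ _ (form_app (least_subsol s1) i)).
    apply: form_app_le => j; rewrite mulr_ge0 ?(ltW q0) ?(ltW (u0 j)) //=.
    have [/andP[_ sj1] sj] := hs j; apply: (le_trans (ltW sj)).
    apply: least_mono => //.
    by rewrite rs1 (le_trans s10).
  have [u1' /(_ i) h] := least_subsolP n0 (neS _ s1P); apply: (le_trans h).
  rewrite ler_wpM2l ?(le_trans r_ge0 (ltW rs1)) //.
  rewrite lerXn2r ?nnegrE ?(ltW (u0 i)) //; last exact: u_ub.
  exact: le_trans (u1' i).
(* Letting the level [s1] in [key] decrease to [r] contradicts the choice of [q]. *)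
suff : q ^+ d * S <= r * u i ^+ d by rewrite -ler_pdivlMr // leNgt hq.
have ud0 : 0 < u i ^+ d by rewrite exprn_gt0.
rewrite -ler_pdivrMr //; apply/ler_addgt0Pr => e e0.
have [rs0 s0r1] := andP s0r.
rewrite ler_pdivrMr //; case: (leP s0 (r + e)) => [h|h].
  by apply: (le_trans (key s0 rs0 (lexx _))); rewrite ler_wpM2r // ltW.
by apply: key; rewrite ?ltrDl // ltW.
Qed.

(** Irreducibility enters the extremal arguments in this form: a nonempty proper set of indices has
    an outgoing arc. *)
Lemma connect_crossing (S : {set 'I_n}) i j : connect form_arc i j ->
  i \in S -> j \notin S -> exists k l, [/\ k \in S, l \notin S & form_arc k l].
Proof.
case/connectP=> p; elim: p i => [|l p IH] i /=; first by move=> _ -> ->.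
move=> /andP[il lp] ej iS jS; case: (boolP (l \in S)) => lS; last by exists i, l.
exact: IH lp ej lS jS.
Qed.

(* Shrinking v on the rows where the inequality is strict keeps them strict
   and makes strict every tight row with an arc to such a row. *)
Lemma strict_subsol r v : (forall i, 0 < v i) ->
  (forall i, form_app v i <= r * v i ^+ d) ->
  (exists i, form_app v i < r * v i ^+ d) ->
  exists w, (forall i, 0 < w i) /\ forall i, form_app w i < r * w i ^+ d.
Proof.
have [m] := ubnP #|[set i | form_app v i == r * v i ^+ d]%SET|.
elim: m v => // m IH v; set S := [set i | _]%SET => lt_m v0 hv [i hi].
have iS : i \notin S by rewrite inE lt_eqF.
have [S0|[j jS]] := set_0Vmem S.
  exists v; split=> // l; rewrite lt_neqAle hv andbT.
  by have := finset.in_set0 l; rewrite -S0 inE => ->.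
have r0 : 0 < r.
  have := le_lt_trans (form_app_ge0 i (fun j => ltW (v0 j))) hi.
  by rewrite pmulr_lgt0 // exprn_gt0.
(* One shrinking factor for all strict rows: the maximum of the factors that work row by row. *)
have [q [q0 q1 hq]] : exists q : R, [/\ 0 < q, q < 1 & forall l, l \notin S ->
    form_app v l < r * (q * v l) ^+ d].
  have /choice[q hq] : forall l, exists q : R, [/\ 0 < q, q < 1 & l \notin S ->
      form_app v l < r * (q * v l) ^+ d].
    move=> l; case: (boolP (l \in S)) => lS.
      by exists 2^-1; split => //; lra.
    have rv0 : 0 < r * v l ^+ d by rewrite mulr_gt0 ?exprn_gt0.
    have [|q [q0 q1 hq]] := @exists_expr_gt R d (form_app v l / (r * v l ^+ d)).
      rewrite ltr_pdivrMr // mul1r lt_neqAle hv andbT.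
      by move: lS; rewrite inE.
    exists q; split=> // _; move: hq; rewrite ltr_pdivrMr // exprMn.
    by rewrite mulrCA.
  exists (\big[Order.max/2^-1]_l q l); split.
  - by apply: (@lt_le_trans _ _ 2^-1); [lra|exact: bigmax_ge_id].
  - by apply/bigmax_ltP; split=> [|l _]; [lra|case: (hq l)].
  move=> l lS; have [ql0 _ /(_ lS) h] := hq l; apply: (lt_le_trans h).
  rewrite ler_wpM2l ?(ltW r0) // lerXn2r ?nnegrE ?mulr_ge0 ?(ltW (v0 l)) ?(ltW ql0) //.
    by apply: (@le_trans _ _ 2^-1); [lra|exact: bigmax_ge_id].
  by rewrite ler_wpM2r ?(ltW (v0 l)) //; apply: le_bigmax_cond.
pose w l := if l \in S then v l else q * v l.
have w0 l : 0 < w l by rewrite /w; case: ifP => // _; rewrite mulr_gt0.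
have wv l : 0 <= w l <= v l.
  by rewrite ltW //= /w; case: ifP => // _; rewrite ger_pMl // ltW.
have w_strict l : l \notin S -> form_app w l < r * w l ^+ d.
  move=> lS; apply: (le_lt_trans (form_app_le l wv)).
  by rewrite /w (negPf lS); apply: hq.
have wS l : l \in S -> form_app w l <= r * w l ^+ d.
  by move=> lS; apply: (le_trans (form_app_le l wv)); rewrite /w lS.
(* Rows outside [S] remain strict, and an arc leaving [S] makes at least one further row strict, so
   the number of tight rows drops. *)
apply: (IH w) => //.
- apply: (@leq_trans #|S|); last by [].
  have [k [l [kS lS kl]]] := connect_crossing (a_irr j i) jS iS.
  apply/proper_card/properP; split.
    apply/fintype.subsetP => e; rewrite inE => he.
    by apply: contraLR he => /w_strict /lt_eqF ->.
  exists k => //; rewrite inE lt_eqF //.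
  apply: (@lt_le_trans _ _ (form_app v k)).
    apply: form_app_lt kl _ => //.
    by rewrite /w (negPf lS) gtr_pMl.
  by rewrite /w kS.
- by move=> l; case: (boolP (l \in S)) => [/wS //|/w_strict/ltW].
by exists i; apply: w_strict.
Qed.

(** A subsolution at the infimal level must be an eigenvector: one strict row could be spread to all
    rows, and the largest ratio [form_app w i / w i ^+ d] would then be an admissible level below
    the infimum. *)
Theorem positive_eigenvector : (0 < n)%N ->
  exists v r, (forall i, 0 < v i) /\ forall i, form_app v i = r * v i ^+ d.
Proof.
move=> n0; have [v [v1 hv]] := subsol_inf_attained n0.
have v0 i : 0 < v i by apply: lt_le_trans (v1 i).
exists v, subsol_inf; split=> // i; apply/eqP; apply: contraT => ne.
have [|w [w0 hw]] := strict_subsol v0 hv.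
  by exists i; rewrite lt_neqAle ne hv.
pose f i := form_app w i / w i ^+ d.
pose s := \big[Order.max/f i]_j f j.
pose c := \big[Order.min/w i]_j w j.
have wd0 j : 0 < w j ^+ d by rewrite exprn_gt0.
have flt j : f j < subsol_inf by rewrite /f ltr_pdivrMr.
have : s < subsol_inf by apply/bigmax_ltP; split=> [|j _]; apply: flt.
rewrite ltNge => /negP[]; apply: subsol_inf_le => //.
exists (fun j => c^-1 * w j); apply: subsol_scale => [|j|j].
- by apply/bigmin_gtP; split.
- exact: bigmin_le_cond.
by rewrite -ler_pdivrMr //; apply: le_bigmax_cond.
Qed.

End PerronFrobenius.

(** * Eigenvectors of maximal modulus *)

Section MaximumPrinciple.
Variables (R : realType) (n d : nat) (a : 'I_n -> d.-tuple 'I_n -> R).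
Hypothesis a_ge0 : forall i t, 0 <= a i t.
Hypothesis a_irr : forall i j, connect (form_arc a) i j.

(** Scale [v] by the least [s] with [p <= s * v] and compare both sides at an index of contact. If
    [m = r], strict monotonicity along arcs makes the contact set closed under arcs, hence
    everything. *)
Lemma collatz_wielandt (v p : 'I_n -> R) r m : (forall i, 0 < v i) ->
  (forall i, form_app a v i = r * v i ^+ d) -> (forall i, 0 <= p i) ->
  (exists i, p i != 0) -> (forall i, m * p i ^+ d <= form_app a p i) ->
  m <= r /\ (m = r -> (forall i, 0 < p i) /\
                      forall i, form_app a p i = r * p i ^+ d).
Proof.
move=> v0 hv p0 [j pj] hp.
pose i0 := [arg max_(i > j) (p i / v i)]%O.
have i0max i : p i / v i <= p i0 / v i0.
  by rewrite /i0; case: arg_maxP => // l _; apply.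
set s := p i0 / v i0 in i0max.
have i0E : p i0 = s * v i0 by rewrite divfK // gt_eqF.
have s0 : 0 < s.
  by apply: lt_le_trans (i0max j); rewrite divr_gt0 // lt_def pj p0.
clearbody s.
have psv i : 0 <= p i <= s * v i by rewrite p0 -ler_pdivrMr ?i0max.
have sv0 i : 0 < s * v i by rewrite mulr_gt0.
have hsv i : form_app a (fun j => s * v j) i = r * (s * v i) ^+ d.
  by rewrite form_appZ hv exprMn mulrCA.
have pi0 : 0 < p i0 by rewrite i0E.
have mr : m <= r.
  have := le_trans (hp i0) (form_app_le a_ge0 i0 psv).
  by rewrite hsv -i0E ler_pM2r // exprn_gt0.
split=> // mr_eq.
suff pE i : p i = s * v i.
  have {}pE : p = fun j => s * v j by apply/funext.
  by split=> i; rewrite pE.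
apply/eqP; apply: contraT => ne.
pose S := [set i | p i == s * v i]%SET.
have [||k [l [kS lS kl]]] := @connect_crossing _ _ _ a S i0 i (a_irr i0 i).
- by rewrite inE i0E.
- by rewrite inE.
have := hp k; rewrite leNgt => /negP[]; move: kS; rewrite inE => /eqP kE.
rewrite mr_eq kE -hsv; apply: form_app_lt kl _ => //.
by rewrite lt_neqAle; move: lS; rewrite inE => -> /=; case/andP: (psv l).
Qed.

(** At a maximum of [f] the weighted mean of the nonnegative differences [f i0 - f j] is zero, so
    [f] is also maximal at every out-neighbour. The set of maxima is therefore closed under arcs. *)
Lemma mean_value_constant (W : 'I_n -> d.-tuple 'I_n -> R) (f : 'I_n -> R) :
  (forall i t, 0 <= W i t) -> (forall i t, a i t != 0 -> W i t != 0) ->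
  (forall i, \sum_t W i t = 1) ->
  (forall i, \sum_t W i t * \sum_(j <- t) f j = d%:R * f i) ->
  forall i j, f i = f j.
Proof.
move=> W0 Wa W1 hf i1 j1.
pose i0 := [arg max_(i > i1) f i]%O.
have i0max i : f i <= f i0 by rewrite /i0; case: arg_maxP => // l _; apply.
suff E i : f i = f i0 by rewrite !E.
apply/eqP; apply: contraT => ne.
pose S := [set i | f i == f i0]%SET.
have [||k [l [kS lS]]] := @connect_crossing _ _ _ a S i0 i (a_irr i0 i).
- by rewrite inE.
- by rewrite inE.
case/existsP=> t /andP[akt lt].
have sum0 : \sum_t W k t * \sum_(j <- t) (f i0 - f j) = 0.
  transitivity (\sum_t W k t * (d%:R * f i0) - \sum_t W k t * \sum_(j <- t) f j).
    rewrite -sumrB; apply: eq_bigr => u _; rewrite sumrB mulrBr.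
    by rewrite big_const_seq count_predT size_tuple iter_addr_0 mulr_natl.
  rewrite -mulr_suml W1 hf mul1r; move: kS; rewrite inE => /eqP ->.
  by rewrite subrr.
have term0 (u : d.-tuple 'I_n) : 0 <= \sum_(j <- u) (f i0 - f j).
  by apply: sumr_ge0 => j _; rewrite subr_ge0.
have /eqP : W k t * \sum_(j <- t) (f i0 - f j) = 0.
  by apply: (psumr_eq0P _ sum0) => // u _; apply: mulr_ge0.
rewrite mulf_eq0 (negPf (Wa _ _ akt)) /= (big_rem l) //=.
rewrite paddr_eq0 ?subr_ge0 //; last by apply: sumr_ge0 => j _; rewrite subr_ge0.
by case/andP=> /eqP/subr0_eq lE _; move: lS; rewrite inE lE eqxx.
Qed.

End MaximumPrinciple.

(** * Directional derivatives and the forms of the eigenvalue system *)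

Section Directional.
Variables (R : comNzRingType) (n : nat).
Implicit Types (f g : {mpoly R[n]}) (x y : 'rV[R]_n).

Definition dirderiv x y f : R := \sum_b y 0 b * (f^`M(b)).@[x 0].

Lemma dirderivZ x y c f : dirderiv x y (c *: f) = c * dirderiv x y f.
Proof.
by rewrite mulr_sumr; apply: eq_bigr => b _; rewrite mderivZ mevalZ mulrCA.
Qed.

Lemma dirderivB x y : {morph dirderiv x y : f g / f - g}.
Proof.
move=> f g; rewrite -sumrB; apply: eq_bigr => b _.
by rewrite mderivB mevalB mulrBr.
Qed.

Lemma dirderivD x y : {morph dirderiv x y : f g / f + g}.
Proof.
move=> f g; rewrite -big_split; apply: eq_bigr => b _.
by rewrite mderivD mevalD mulrDr.
Qed.

Lemma dirderivC x y c : dirderiv x y c%:MP = 0.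
Proof. by apply: big1 => b _; rewrite mderivC meval0 mulr0. Qed.

Lemma dirderivM x y f g :
  dirderiv x y (f * g) = dirderiv x y f * g.@[x 0] + f.@[x 0] * dirderiv x y g.
Proof.
rewrite mulr_suml mulr_sumr -big_split /=; apply: eq_bigr => b _.
by rewrite mderivM mevalD !mevalM mulrDr !mulrA [_ * f.@[_]]mulrC.
Qed.

Lemma dirderivX x y i : dirderiv x y 'X_i = y 0 i.
Proof.
have dX b : ('X_i : {mpoly R[n]})^`M(b) = ((b == i)%:R)%:MP.
  rewrite mderivX mnm1E eq_sym; case: eqP => [->|_].
    rewrite scale1r (_ : (_ - _)%MM = 0%MM) ?mpolyX0 //.
    by apply/mnmP => l; rewrite mnmBE subnn mnm0E.
  by rewrite scale0r.
rewrite /dirderiv (bigD1 i) //= big1 => [|b bi].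
  by rewrite dX mevalC eqxx mulr1 addr0.
by rewrite dX mevalC (negPf bi) mulr0.
Qed.

(** A logarithmic derivative: writing the direction as [x] times [eta] makes each factor of a
    monomial contribute its [eta j]. This is what turns the Jacobian equations into a mean value
    identity. *)
Lemma dirderiv_prod x y (eta : 'I_n -> R) (s : seq 'I_n) :
  (forall i, y 0 i = x 0 i * eta i) ->
  dirderiv x y (\prod_(j <- s) 'X_j) =
    (\prod_(j <- s) x 0 j) * \sum_(j <- s) eta j.
Proof.
move=> yE; elim: s => [|i s IH].
  by rewrite !big_nil mulr0 -[1]/(1%:MP) dirderivC.
rewrite !big_cons dirderivM dirderivX mevalXU IH yE rmorph_prod /=.
under eq_bigr do rewrite mevalXU.
by rewrite mulrDr -!mulrA [eta i * _]mulrC.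
Qed.

Lemma dirderiv_exp x y (eta : 'I_n -> R) i m :
  (forall i, y 0 i = x 0 i * eta i) ->
  dirderiv x y ('X_i ^+ m) = x 0 i ^+ m * (m%:R * eta i).
Proof.
move=> yE; have := dirderiv_prod (nseq m i) yE.
by rewrite !big_nseq !iter_mulr_1 iter_addr_0 mulr_natl.
Qed.

End Directional.

Lemma meval_sum (R : comNzRingType) n (v : 'I_n -> R) I (r : seq I) (P : pred I)
    (F : I -> {mpoly R[n]}) :
  (\sum_(i <- r | P i) F i).@[v] = \sum_(i <- r | P i) (F i).@[v].
Proof. exact: (big_morph _ (mevalD v) (meval0 v)). Qed.

Section EigenForms.
Variables (C : numClosedFieldType) (k n : nat).
Implicit Types (A : tensor C k n) (x y : 'rV[C]_n) (lambda : C).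

Definition eig_form A lambda i : {mpoly C[n]} :=
  lambda *: 'X_i ^+ k.-1 -
  \sum_(t : (k.-1).-tuple 'I_n) A i t *: \prod_(j <- t) 'X_j.

Lemma eig_formE A lambda i x : (eig_form A lambda i).@[x 0] =
  lambda * x 0 i ^+ k.-1 - \sum_(t : (k.-1).-tuple 'I_n) A i t * \prod_(j <- t) x 0 j.
Proof.
rewrite mevalB mevalZ rmorphXn /= mevalXU meval_sum; congr (_ - _).
apply: eq_bigr => t _; rewrite mevalZ rmorph_prod /=; congr (_ * _).
by apply: eq_bigr => j _; rewrite mevalXU.
Qed.

Lemma affine_eigenvarietyP A lambda x :
  affine_eigenvariety A lambda x <-> forall i, (eig_form A lambda i).@[x 0] = 0.
Proof.
split=> [E i|E].
  by have /rowP/(_ i) := E; rewrite !mxE eig_formE => ->; rewrite subrr.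
by apply/rowP => i; have /eqP := E i; rewrite !mxE eig_formE subr_eq0 eq_sym => /eqP.
Qed.

Lemma dhomog_prod_seq d (s : seq 'I_n) : size s = d ->
  (\prod_(j <- s) 'X_j : {mpoly C[n]}) \is d.-homog.
Proof.
elim: s d => [|i s IH] d <-; first by rewrite big_nil dhomog1.
rewrite big_cons -[(size _)]add1n; apply: dhomogM; last exact: IH.
by rewrite dhomogX; apply/eqP/mdeg1.
Qed.

Lemma eig_form_homog A lambda i : eig_form A lambda i \is (k.-1).-homog.
Proof.
rewrite rpredB //; last first.
  by apply: rpred_sum => t _; apply: rpredZ; rewrite dhomog_prod_seq ?size_tuple.
rewrite rpredZ //; have := @dhomog_prod_seq k.-1 (nseq k.-1 i).
by rewrite big_nseq iter_mulr_1 size_nseq; apply.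
Qed.

Lemma dirderiv_eig_form A lambda i x y (eta : 'I_n -> C) :
  (forall j, y 0 j = x 0 j * eta j) ->
  dirderiv x y (eig_form A lambda i) =
    lambda * x 0 i ^+ k.-1 * ((k.-1)%:R * eta i) -
    \sum_(t : (k.-1).-tuple 'I_n)
       A i t * (\prod_(j <- t) x 0 j) * \sum_(j <- t) eta j.
Proof.
move=> yE; rewrite dirderivB dirderivZ (dirderiv_exp _ _ yE); congr (_ - _).
  by rewrite -!mulrA.
have D0 : dirderiv x y 0 = 0 by rewrite -[X in dirderiv _ _ X]mpolyC0 dirderivC.
rewrite (big_morph _ (dirderivD x y) D0).
by apply: eq_bigr => t _; rewrite dirderivZ (dirderiv_prod _ yE) mulrA.
Qed.

End EigenForms.

(** Here [r] is the Perron eigenvalue. By the triangle inequality the moduli of an eigenvector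
    satisfy the hypothesis of [collatz_wielandt] with [m] the modulus of [lambda]; the equality case
    gives positivity and aligned phases. *)
Lemma eigenvectors_of_maximal_modulus (R : realType) (k n : nat)
    (A : tensor R[i] k n) : (0 < n)%N ->
  nonneg_tensor A -> weakly_irreducible A ->
  exists2 r : R[i], 0 <= r /\ eigenvalue_of A r &
    forall (lambda : R[i]) (x : 'rV[R[i]]_n),
      x != 0 -> affine_eigenvariety A lambda x ->
      `|lambda| <= r /\
      (`|lambda| = r -> (forall i, x 0 i != 0) /\
         forall y, (forall i, dirderiv x y (eig_form A lambda i) = 0) ->
           exists c, y = c *: x).
Proof.
move=> n0 A0 Airr.
pose a i t := complex.Re (A i t).
have AE i t : A i t = (a i t)%:C%C by rewrite RRe_real // ger0_real.
have a0 i t : 0 <= a i t by rewrite -ler0c -AE.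
have airr i j : connect (form_arc a) i j.
  have := Airr i j; congr is_true; apply: eq_connect => {}i {}j.
  by apply: eq_existsb => t; rewrite AE fmorph_eq0.
have [v [r [v0 hv]]] := positive_eigenvector a0 airr n0.
have r0 : 0 <= r.
  have := form_app_ge0 a0 (Ordinal n0) (fun j => ltW (v0 j)).
  by rewrite hv pmulr_lge0 // exprn_gt0.
exists r%:C%C.
  split; first by rewrite ler0c.
  exists (\row_i (v i)%:C%C).
    apply/eqP => /rowP/(_ (Ordinal n0)); rewrite !mxE => /eqP.
    by rewrite fmorph_eq0 gt_eqF.
  apply/rowP => i; rewrite !mxE -rmorphXn -rmorphM -hv rmorph_sum /=.
  apply: eq_bigr => t _; rewrite rmorphM rmorph_prod AE /=; congr (_ * _).
  by apply: eq_bigr => j _; rewrite mxE.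
move=> lambda x x0 /affine_eigenvarietyP xE.
pose p i := complex.Re `|x 0 i|; pose m := complex.Re `|lambda|.
have pE i : (p i)%:C%C = `|x 0 i| by rewrite RRe_real // normr_real.
have mE : m%:C%C = `|lambda| by rewrite RRe_real // normr_real.
have appE i : (form_app a p i)%:C%C = \sum_t `|A i t * \prod_(j <- t) x 0 j|.
  rewrite rmorph_sum; apply: eq_bigr => t _; rewrite rmorphM rmorph_prod /=.
  by rewrite normrM normr_prod AE ger0_norm ?ler0c //; congr (_ * _).
have sumE i : \sum_t A i t * \prod_(j <- t) x 0 j = lambda * x 0 i ^+ k.-1.
  by have /eqP := xE i; rewrite eig_formE subr_eq0 eq_sym => /eqP.
have [||i|mr mrE] := collatz_wielandt a0 airr v0 hv (p := p) (m := m).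
- by move=> i; rewrite -ler0c pE normr_ge0.
- have [i xi] := rV0Pn x x0.
  by exists i; rewrite -(fmorph_eq0 (real_complex R)) /= pE normr_eq0.
- rewrite -lecR rmorphM rmorphXn /= appE mE pE -normrX -normrM -sumE.
  exact: ler_norm_sum.
split; first by rewrite -mE lecR.
rewrite -mE => /complexI mr_eq; have [p0 hp] := mrE mr_eq.
have x_neq0 i : x 0 i != 0 by rewrite -normr_eq0 -pE fmorph_eq0 gt_eqF.
split=> // y hy.
(* The weights below divide by [lambda]. If it is 0, positivity of [p] forces all entries of [a] to
   vanish, so there are no arcs and irreducibility leaves a single index. *)
have [l0|l0] := eqVneq lambda 0.
  have a_eq0 i t : a i t = 0.
    have /eqP : a i t * \prod_(j <- t) p j = 0.
      apply: (@psumr_eq0P _ _ predT (fun t => a i t * \prod_(j <- t) p j)) => //.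
        by move=> u _; rewrite mulr_ge0 // prodr_ge0 // => j _; rewrite ltW.
      rewrite -[LHS]/(form_app a p i) hp -mr_eq; apply/eqP.
      by rewrite mulf_eq0 -(fmorph_eq0 (real_complex R)) /= mE l0 normr0 eqxx.
    by rewrite mulf_eq0 => /orP[/eqP //|]; rewrite gt_eqF // prodr_gt0.
  have i_eq (i j : 'I_n) : i = j.
    have /connectP[[_ -> //|l q /andP[/existsP[t]]]] := airr i j.
    by rewrite a_eq0 eqxx.
  exists (y 0 (Ordinal n0) / x 0 (Ordinal n0)); apply/rowP => i.
  by rewrite mxE (i_eq (Ordinal n0) i) divfK.
pose eta i : R[i] := y 0 i / x 0 i.
have yE i : y 0 i = x 0 i * eta i by rewrite mulrC divfK.
pose z i : R[i] := lambda * x 0 i ^+ k.-1.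
have z0 i : z i != 0 by rewrite mulf_neq0 // expf_neq0.
pose W i t : R[i] := A i t * (\prod_(j <- t) x 0 j) / z i.
have W1 i : \sum_t W i t = 1 by rewrite -mulr_suml sumE -/(z i) divff.
(* Equality holds in the triangle inequality, so all terms of row [i] share one phase [w], which is
   also the phase of their sum [z i]. *)
have W_ge0 i t : 0 <= W i t.
  have [|w /eqP w1 hw] :=
    @normC_sum_eq _ _ predT (fun t => A i t * \prod_(j <- t) x 0 j).
    by rewrite sumE normrM normrX -appE hp rmorphM rmorphXn /= pE -mr_eq mE.
  have zE : z i = (\sum_t `|A i t * \prod_(j <- t) x 0 j|) * w.
    by rewrite /z -sumE mulr_suml; apply: eq_bigr => u _; apply: hw.
  have w0 : w != 0 by rewrite -normr_eq0 w1 oner_eq0.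
  rewrite /W hw // zE -mulf_div divff // mulr1.
  by rewrite divr_ge0 // sumr_ge0.
have WR i t : (complex.Re (W i t))%:C%C = W i t by rewrite RRe_real // ger0_real.
have mean i : \sum_t W i t * \sum_(j <- t) eta j = (k.-1)%:R * eta i.
  have /eqP := hy i; rewrite (dirderiv_eig_form _ _ _ yE) subr_eq0 => /eqP h.
  apply: (mulfI (z0 i)); rewrite /z h mulr_sumr; apply: eq_bigr => t _.
  by rewrite mulrA; congr (_ * _); rewrite mulrC divfK.
(* The maximum principle needs ordered values, so it is applied to the real and imaginary parts of
   [eta] separately. *)
have eta_const (f : R[i] -> R) : {morph f : u w / u + w} -> f 0 = 0 ->
    (forall c u, f (c%:C%C * u) = c * f u) -> forall i j, f (eta i) = f (eta j).
  move=> fD f0 fZ.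
  have f_sum I (s : seq I) (F : I -> R[i]) :
      f (\sum_(i <- s) F i) = \sum_(i <- s) f (F i).
    exact: (big_morph f fD f0).
  apply: (mean_value_constant (a := a) airr (W := fun i t => complex.Re (W i t))
    (f := fun i => f (eta i))).
  - by move=> i t; rewrite -ler0c WR.
  - move=> i t ait; rewrite -(fmorph_eq0 (real_complex R)) /= WR.
    rewrite !mulf_neq0 ?invr_eq0 ?AE ?fmorph_eq0 //.
    by rewrite prodf_seq_neq0; apply/allP => j _ /=.
  - move=> i; apply: complexI; rewrite rmorph_sum rmorph1 -(W1 i).
    by apply: eq_bigr => t _; apply: WR.
  move=> i; rewrite -fZ -[_%:R%:C%C]/(real_complex R _) rmorph_nat -mean f_sum.
  by apply: eq_bigr => t _; rewrite -f_sum -fZ WR.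
exists (eta (Ordinal n0)); apply/rowP => i; rewrite mxE yE mulrC; congr (_ * _).
apply/eqP; rewrite eq_complex; apply/andP; split; apply/eqP; apply: eta_const => //.
- by move=> [? ?] [? ?].
- by move=> c [? ?]; simpc.
- by move=> [? ?] [? ?].
- by move=> c [? ?]; simpc.
Qed.

(** * Lowest homogeneous parts and hyperplanes *)

Section Nonvanishing.
Variable C : numFieldType.

(** In characteristic 0 there are more natural numbers than roots. *)
Lemma poly_nonroot (p : {poly C}) : p != 0 -> exists t, p.[t] != 0.
Proof.
move=> p0; apply: contrapT => h.
have: (size [seq m%:R : C | m <- iota 0 (size p)] < size p)%N.
  apply: max_poly_roots => //.
    apply/allP => t _; apply/eqP; apply: contrapT => /eqP pt.
    by apply: h; exists t.
  by rewrite map_inj_uniq ?iota_uniq //; apply: mulrIn; apply: oner_neq0.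
by rewrite size_map size_iota ltnn.
Qed.

Lemma poly_horner_inj (p q : {poly C}) : (forall t, p.[t] = q.[t]) -> p = q.
Proof.
move=> pq; apply/eqP; rewrite -subr_eq0; apply: contraT => /poly_nonroot[t].
by rewrite hornerD hornerN pq subrr eqxx.
Qed.

(** Uniqueness of digits in base [D], needed to separate the exponents in a Kronecker
    substitution. *)
Lemma radix_inj n D (a b : 'I_n -> nat) :
  (forall i, a i < D)%N -> (forall i, b i < D)%N ->
  (\sum_(i < n) a i * D ^ i = \sum_(i < n) b i * D ^ i)%N -> a =1 b.
Proof.
elim: n a b => [|n IH] a b aD bD; first by move=> _ [].
rewrite !big_ord_recl !expn0 !muln1.
have E (c : 'I_n.+1 -> nat) : (\sum_(i < n) c (lift ord0 i) * D ^ lift ord0 i =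
    (\sum_(i < n) c (lift ord0 i) * D ^ i) * D)%N.
  by rewrite big_distrl; apply: eq_bigr => i _; rewrite lift0 expnSr mulnA.
rewrite !E => h.
have ab0 : a ord0 = b ord0.
  have := congr1 (modn^~ D) h.
  by rewrite /= ![(_ ord0 + _)%N]addnC !modnMDl !modn_small.
have {}h : (\sum_(i < n) a (lift ord0 i) * D ^ i =
            \sum_(i < n) b (lift ord0 i) * D ^ i)%N.
  apply/eqP; rewrite -(eqn_pmul2r (leq_ltn_trans (leq0n _) (aD ord0))).
  by rewrite -(eqn_add2l (a ord0)) {2}ab0 h.
have := IH _ _ (fun i => aD _) (fun i => bD _) h.
by move=> ab i; case: (unliftP ord0 i) => [j ->|->].
Qed.

Lemma mmap_horner n (p : {mpoly C[n]}) (w : 'I_n -> {poly C}) t :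
  (mmap polyC w p).[t] = p.@[fun i => (w i).[t]].
Proof.
rewrite mevalE /mmap horner_sum; apply: eq_bigr => m _.
rewrite hornerM hornerC horner_prod; congr (_ * _).
by apply: eq_bigr => i _; rewrite horner_exp.
Qed.

(* Kronecker substitution: X_i := t^(D^i) separates the monomials of p. *)
Lemma mpoly_nonvanishing n (p : {mpoly C[n]}) : p != 0 -> exists v, p.@[v] != 0.
Proof.
move=> p0; pose D := msize p.
pose q := mmap polyC (fun i : 'I_n => 'X^(D ^ i)) p.
suff /poly_nonroot[t] : q != 0.
  by rewrite mmap_horner; exists (fun i => ('X^(D ^ i)).[t]).
pose e (m : 'X_{1..n}) := (\sum_(i < n) m i * D ^ i)%N.
have qE : q = \sum_(m <- msupp p) p@_m *: 'X^(e m).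
  apply: eq_bigr => m _; rewrite mul_polyC; congr (_ *: _).
  rewrite /mmap1 /e -prodrXr; apply: eq_bigr => i _.
  by rewrite -exprM mulnC.
have mD (m : 'X_{1..n}) i : m \in msupp p -> (m i < D)%N.
  move/msize_mdeg_lt; apply: leq_ltn_trans.
  by rewrite mdegE (bigD1 i) //= leq_addr.
have [m0 m0p] : exists m, m \in msupp p.
  case E: (msupp p) => [|m s]; last by exists m; rewrite inE eqxx.
  by move/eqP: E; rewrite msupp_eq0 (negPf p0).
suff qe : q`_(e m0) = p@_m0.
  by apply: contraTneq m0p => q0; rewrite -mcoeff_eq0 -qe q0 coef0.
rewrite qE coef_sum (bigD1_seq m0) ?msupp_uniq //= coefZ coefXn eqxx mulr1.
rewrite big_seq_cond big1 ?addr0 // => m /andP[mp mm0].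
rewrite coefZ coefXn; case: eqP => [em|]; last by rewrite mulr0.
case/eqP: mm0; apply/mnmP => i; apply: (@radix_inj n D) => // j; exact: mD.
Qed.

End Nonvanishing.

Section LowestForm.
Variables (C : numFieldType) (n : nat).
Implicit Types (p h : {mpoly C[n]}) (w : 'I_n -> {poly C}).

Lemma mcoeff_pihomog d p m :
  (pihomog mdeg d p)@_m = if mdeg m == d then p@_m else 0.
Proof.
rewrite /pihomog raddf_sum /= big_mkcond /=.
have [mp|mp] := boolP (m \in msupp p); last first.
  rewrite (memN_msupp_eq0 mp) if_same big_seq big1 // => m' m'p.
  case: ifP => // _; rewrite mcoeffZ mcoeffX.
  case: eqP => [mm'|]; last by rewrite mulr0.
  by rewrite mm' (negPf mp) in m'p.
rewrite (bigD1_seq m) ?msupp_uniq //= mcoeffZ mcoeffX eqxx mulr1.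
rewrite big1 ?addr0 // => m' m'm; case: ifP => // _.
by rewrite mcoeffZ mcoeffX (negPf m'm) mulr0.
Qed.

Lemma lowest_form p : p != 0 -> exists d, pihomog mdeg d p != 0 /\
  forall m, m \in msupp p -> (d <= mdeg m)%N.
Proof.
move=> p0.
have ex : exists e, has (fun m => mdeg m == e) (msupp p).
  case E: (msupp p) => [|m s]; last by exists (mdeg m); rewrite /= eqxx.
  by move/eqP: E; rewrite msupp_eq0 (negPf p0).
case: (ex_minnP ex) => d /hasP[m mp /eqP md] dmin; exists d; split.
  apply: contraTneq mp => h; rewrite -mcoeff_eq0.
  by have := mcoeff_pihomog d p m; rewrite h mcoeff0 md eqxx => <-.
by move=> m' m'p; apply: dmin; apply/hasP; exists m'.
Qed.

(** On a curve [t * w(t)] through the origin, a monomial of degree [e] acquires the factor [t ^ e].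
    This gives both the order of vanishing at 0 and the leading coefficient, the lowest form at
    [w(0)]. *)
Lemma mmap_lowest_form d p w : (forall m, m \in msupp p -> (d <= mdeg m)%N) ->
  exists r, mmap polyC (fun i => 'X * w i) p =
            'X^d * (mmap polyC w (pihomog mdeg d p) + 'X * r).
Proof.
move=> dmin; pose c m := (p@_m)%:P * mmap1 w m.
exists (\sum_(m <- msupp p | mdeg m != d) 'X^((mdeg m - d).-1) * c m).
have -> : mmap polyC w (pihomog mdeg d p) = \sum_(m <- msupp p | mdeg m == d) c m.
  rewrite /pihomog (big_morph _ (mmapD w polyC) (mmap0 w polyC)).
  by apply: eq_bigr => m _; rewrite mmapZ mmapX.
have cE m : (p@_m)%:P * mmap1 (fun i => 'X * w i) m = 'X^(mdeg m) * c m.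
  rewrite /mmap1 mulrCA; congr (_ * _); rewrite mdegE -prodrXr -big_split.
  by apply: eq_bigr => i _; rewrite exprMn.
rewrite /mmap (eq_bigr _ (fun m _ => cE m)) mulrDr !mulr_sumr.
rewrite (bigID (fun m => mdeg m == d)) /=; congr (_ + _).
  by apply: eq_bigr => m /eqP ->.
rewrite big_seq_cond [RHS]big_seq_cond; apply: eq_bigr => m /andP[mp md].
have dm : (d < mdeg m)%N by rewrite ltn_neqAle eq_sym md dmin.
rewrite !mulrA -exprSr -exprD; congr ('X^_ * _ * _).
by rewrite addSnnS prednK ?subn_gt0 // addnC subnK // ltnW.
Qed.

Lemma size_mmap_homog d h w : h \is d.-homog -> (forall i, (size (w i) <= 2)%N) ->
  (size (mmap polyC w h) <= d.+1)%N.
Proof.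
move=> /dhomogP hd w2; rewrite /mmap big_seq.
apply: (leq_trans (size_sum _ _ _)); apply/bigmax_leqP_seq => m _ mh.
rewrite mul_polyC; apply: (leq_trans (size_scale_leq _ _)).
have <- : mdeg m = d by apply: hd.
have sizeX (q : {poly C}) e : (size q <= 2)%N -> (size (q ^+ e) <= e.+1)%N.
  move=> q2; apply: (leq_trans (size_poly_exp_leq _ _)); rewrite ltnS.
  by rewrite -[leqRHS]mul1n leq_mul2r; case: (size q) q2 => [|[|[]]] //; rewrite orbT.
rewrite mdegE /mmap1; elim/big_ind2: _ => [|q1 e1 q2 e2 h1 h2|i _].
- by rewrite size_poly1.
- apply: (leq_trans (size_polyMleq _ _)).
  by rewrite -subn1 leq_subLR add1n -addnS -addSn leq_add.
exact: sizeX.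
Qed.

End LowestForm.

Definition pairing (R : pzSemiRingType) n (a g : 'I_n -> R) : R :=
  \sum_c a c * g c.

Section Hyperplanes.
Variables (C : numFieldType) (n : nat).
Implicit Types (a g v : 'I_n -> C).

(** On the moment curve [(1, t, t^2, ...)] each nonzero functional becomes a nonzero polynomial in
    [t], and the product of these has a nonroot. *)
Lemma avoid_hyperplanes (I : finType) (a : I -> 'I_n -> C) :
  (forall s, exists g, pairing (a s) g != 0) ->
  exists g, forall s, pairing (a s) g != 0.
Proof.
move=> ha; pose q s : {poly C} := \sum_c a s c *: 'X^c.
have qE s t : (q s).[t] = pairing (a s) (fun c => t ^+ c).
  by rewrite horner_sum; apply: eq_bigr => c _; rewrite hornerZ hornerXn.
have q0 s : q s != 0.
  have [g] := ha s; apply: contra_neq => qs; apply: big1 => c _.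
  suff -> : a s c = 0 by rewrite mul0r.
  have : (q s)`_c = 0 by rewrite qs coef0.
  rewrite coef_sum (bigD1 c) //= coefZ coefXn eqxx mulr1 big1 ?addr0 // => e ec.
  by rewrite coefZ coefXn eq_sym (negPf (ec : (e != c :> nat))) mulr0.
have /poly_nonroot[t] : \prod_s q s != 0 by apply/prodf_neq0.
rewrite horner_prod => /prodf_neq0 ht.
by exists (fun c => t ^+ c) => s; rewrite -qE ht.
Qed.

(** Restrict [h] to a line [g0 + t K] with [h(g0)] nonzero. For suitable [K] it meets the [N]
    hyperplanes at [N] distinct parameters, all roots of a nonzero polynomial of degree at most
    [d]. *)
Lemma homog_vanishing_on_hyperplanes (N d : nat) (h : {mpoly C[n]})
    (a : 'I_N -> 'I_n -> C) : h != 0 -> h \is d.-homog ->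
  (forall j g, pairing (a j) g = 0 -> h.@[g] = 0) ->
  (forall j l, j != l -> exists g, pairing (a j) g = 0 /\ pairing (a l) g != 0) ->
  (N <= d)%N.
Proof.
move=> h0 hd ha a_ne; have [g0 hg0] := mpoly_nonvanishing h0.
have e0 j : pairing (a j) g0 != 0.
  by apply: contra_neq hg0; apply: ha.
(* Normalized to take the value 1 at [g0], so that the line meets hyperplane [j] at
   [t = - 1 / b_j(K)]. *)
pose b j c := a j c / pairing (a j) g0.
have bE j g : pairing (b j) g = pairing (a j) g / pairing (a j) g0.
  by rewrite mulr_suml; apply: eq_bigr => c _; rewrite mulrAC.
(* The diagonal functionals make these parameters exist; the off-diagonal differences make them
   distinct. *)
pose u (jl : 'I_N * 'I_N) c := if jl.1 == jl.2 then b jl.1 c else b jl.1 c - b jl.2 c.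
have uE j l g : pairing (u (j, l)) g =
    if j == l then pairing (b j) g else pairing (b j) g - pairing (b l) g.
  rewrite /u /=; case: ifP => // _; rewrite -sumrB.
  by apply: eq_bigr => c _; rewrite mulrBl.
have [[j l]|K hK] := @avoid_hyperplanes _ u.
  have [<-|jl] := eqVneq j l.
    by exists g0; rewrite uE eqxx bE divff ?oner_eq0.
  have [g [gj gl]] := a_ne j l jl; exists g.
  by rewrite uE (negPf jl) !bE gj mul0r sub0r oppr_eq0 mulf_neq0 ?invr_eq0.
have bK j : pairing (b j) K != 0 by have := hK (j, j); rewrite uE eqxx.
have bKne j l : j != l -> pairing (b j) K != pairing (b l) K.
  by move=> jl; have := hK (j, l); rewrite uE (negPf jl) subr_eq0.
pose w c : {poly C} := (g0 c)%:P + K c *: 'X.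
pose f := mmap polyC w h.
have wE s c : (w c).[s] = g0 c + K c * s.
  by rewrite hornerD hornerC hornerZ hornerX.
have fE s : f.[s] = h.@[fun c => g0 c + K c * s].
  by rewrite mmap_horner; apply: meval_eq => c; rewrite wE.
have f0 : f != 0.
  apply: contra_neq hg0 => f0; have := fE 0; rewrite f0 horner0 => ->.
  by apply: meval_eq => c; rewrite mulr0 addr0.
have f_size : (size f <= d.+1)%N.
  apply: size_mmap_homog => // c; rewrite (leq_trans (size_polyD _ _)) //.
  rewrite geq_max (leq_trans (size_polyC_leq1 _)) //=.
  by rewrite (leq_trans (size_scale_leq _ _)) // size_polyX.
pose root_of j := - (pairing (b j) K)^-1.
have: (size [seq root_of j | j <- enum 'I_N] < size f)%N.
  apply: max_poly_roots => //.
    apply/allP => _ /mapP[j _ ->]; apply/eqP; rewrite fE; apply: (ha j).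
    have -> : pairing (a j) (fun c => g0 c + K c * root_of j) =
        pairing (a j) g0 * (1 + pairing (b j) K * root_of j).
      rewrite mulrDr mulr1 mulrA bE [_ * (_ / _)]mulrC divfK //.
      rewrite /pairing mulr_suml -big_split /=.
      by apply: eq_bigr => c _; rewrite mulrDr mulrA.
    by rewrite mulrN divff // subrr mulr0.
  rewrite map_inj_uniq ?enum_uniq // => j l /oppr_inj/invr_inj jl.
  by apply/eqP; apply: contraT => /bKne; rewrite jl eqxx.
by rewrite size_map size_enum_ord => /leq_trans/(_ f_size).
Qed.

End Hyperplanes.

(** * Zeros of the resultant *)

Section FormCoefficients.
Variables (C : comNzRingType) (n d : nat).
Implicit Types (F : 'I_n -> {mpoly C[n]}) (g : 'I_#|coef_index n d| -> C).

Definition form_of g (i : 'I_n) : {mpoly C[n]} :=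
  \sum_(m : homog_monom n d) g (enum_rank (i, m)) *: 'X_[bmnm (val m)].

(** The point at which [eval_coef] evaluates the resultant; on forms of degree [d] it is inverse to
    [form_of]. *)
Definition coefs_of F : 'I_#|coef_index n d| -> C :=
  fun j => let u := enum_val j in (F u.1)@_(bmnm (val u.2)).

Lemma homog_monom_ex (m : 'X_{1..n}) :
  mdeg m = d -> exists mu : homog_monom n d, bmnm (val mu) = m.
Proof.
move=> md; have md' : (mdeg m < d.+1)%N by rewrite md.
have h : mdeg (bmnm (BMultinom md')) == d by rewrite /= md.
by exists (exist _ (BMultinom md') h).
Qed.

Lemma homog_monom_inj : injective (fun mu : homog_monom n d => bmnm (val mu)).
Proof. by move=> mu nu h; apply/val_inj/val_inj. Qed.

Lemma mcoeff_form_of g i (mu : homog_monom n d) :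
  (form_of g i)@_(bmnm (val mu)) = g (enum_rank (i, mu)).
Proof.
rewrite raddf_sum (bigD1 mu) //= mcoeffZ mcoeffX eqxx mulr1.
rewrite big1 ?addr0 // => nu numu; rewrite mcoeffZ mcoeffX.
by case: eqP => [/homog_monom_inj/eqP|]; rewrite ?(negPf numu) // mulr0.
Qed.

Lemma form_ofK g : coefs_of (form_of g) =1 g.
Proof.
by move=> j; rewrite /coefs_of /= mcoeff_form_of -surjective_pairing enum_valK.
Qed.

Lemma form_of_homog g i : form_of g i \is d.-homog.
Proof.
apply: rpred_sum => mu _; apply: rpredZ; rewrite dhomogX; exact: (valP mu).
Qed.

Lemma coefs_ofK F i : F i \is d.-homog -> form_of (coefs_of F) i = F i.
Proof.
move=> Fd; apply/mpolyP => m; have [md|md] := eqVneq (mdeg m) d.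
  have [mu <-] := homog_monom_ex md.
  by rewrite mcoeff_form_of /coefs_of enum_rankK.
by rewrite !(dhomog_nemf_coeff _ md) ?form_of_homog.
Qed.

Lemma meval_form_of g i (x : 'I_n -> C) : (form_of g i).@[x] =
  \sum_(m : homog_monom n d) g (enum_rank (i, m)) * mmap1 x (bmnm (val m)).
Proof.
by rewrite meval_sum; apply: eq_bigr => m _; rewrite mevalZ mevalX.
Qed.

(** Displays the functional whose kernel is the hyperplane H_x, when [w] spans the cokernel of the
    Jacobian at [x]. *)
Lemma meval_form_of_pairing g (w : 'cV[C]_n) (x : 'I_n -> C) :
  pairing (fun j => let u := enum_val j in w u.1 0 * mmap1 x (bmnm (val u.2))) g =
  \sum_i w i 0 * (form_of g i).@[x].
Proof.
under [RHS]eq_bigr do rewrite meval_form_of mulr_sumr.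
rewrite pair_big /= /pairing (reindex (@enum_rank (coef_index n d))) /=; last first.
  by exists enum_val => ? _; rewrite ?enum_rankK ?enum_valK.
apply: eq_bigr => -[i m] _; rewrite enum_rankK /= -mulrA.
by congr (_ * _); rewrite mulrC.
Qed.

End FormCoefficients.

Arguments coefs_of {C n} d F _.

(** * First-order expansion along lines and the cokernel of the Jacobian *)

Section LinePath.
Variables (C : numFieldType) (n : nat).
Implicit Types (f : {mpoly C[n]}) (x y : 'rV[C]_n).

Definition along x y f : {poly C} :=
  mmap polyC (fun b => (x 0 b)%:P + y 0 b *: 'X) f.

Lemma horner_along x y f t : (along x y f).[t] = f.@[(x + t *: y) 0].
Proof.
rewrite mmap_horner; apply: meval_eq => b.
by rewrite hornerD hornerC hornerZ hornerX !mxE mulrC.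
Qed.

Lemma along_coef01 x y f :
  (along x y f)`_0 = f.@[x 0] /\ (along x y f)`_1 = dirderiv x y f.
Proof.
split.
  by rewrite -horner_coef0 horner_along scale0r addr0.
pose P f := (along x y f)`_1 = dirderiv x y f.
rewrite -/(P f).
have coef0E q : (along x y q)`_0 = q.@[x 0].
  by rewrite -horner_coef0 horner_along scale0r addr0.
have PC c : P c%:MP by rewrite /P /along mmapC dirderivC coefC.
have PD : forall p q, P p -> P q -> P (p + q).
  by move=> p q hp hq; rewrite /P /along mmapD coefD dirderivD -hp -hq.
have PM : forall p q, P p -> P q -> P (p * q).
  move=> p q hp hq; rewrite /P /along rmorphM coefM dirderivM -hp -hq.
  rewrite !big_ord_recl big_ord0 /= !coef0E addr0 addrC mulrC.
  by congr (_ + _); rewrite mulrC.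
have PX i : P 'X_i.
  by rewrite /P /along mmapX mmap1U dirderivX coefD coefC coefZ coefX add0r mulr1.
have PXm m : P 'X_[m].
  rewrite mpolyXE_id; apply: (big_ind P) => // [|i _]; first exact: PC 1.
  by elim: (m i) => [|e IH]; [exact: PC 1|rewrite exprS; apply: PM].
elim/mpolyind: f => [|c m p _ _ Pp]; first by have := PC 0; rewrite mpolyC0.
by apply: PD => //; rewrite -mul_mpolyC; apply: PM.
Qed.

End LinePath.

Lemma meval_homogZ (C : comNzRingType) (n d : nat) (f : {mpoly C[n]}) c
    (x : 'rV[C]_n) :
  f \is d.-homog -> f.@[(c *: x) 0] = c ^+ d * f.@[x 0].
Proof.
move=> /dhomogP fd; rewrite !mevalE mulr_sumr big_seq [RHS]big_seq.
apply: eq_bigr => m mf; rewrite mulrCA; congr (_ * _).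
have <- : mdeg m = d by apply: fd.
rewrite mdegE -prodrXr -big_split; apply: eq_bigr => i _.
by rewrite mxE exprMn.
Qed.

(** By homogeneity [f] vanishes on the whole line through [x], so its linear coefficient there is 0.
    Thus a zero of a system always lies in the kernel of its Jacobian. *)
Lemma euler_zero (C : numFieldType) (n d : nat) (f : {mpoly C[n]}) (x : 'rV[C]_n) :
  f \is d.-homog -> f.@[x 0] = 0 -> dirderiv x x f = 0.
Proof.
move=> fd fx; have [_ <-] := along_coef01 x x f.
suff -> : along x x f = 0 by rewrite coef0.
apply: poly_horner_inj => t; rewrite horner_along horner0.
by rewrite -{1}[x]scale1r -scalerDl (meval_homogZ _ _ fd) fx mulr0.
Qed.

(** The left kernel is exactly a line, so the cokernel has rank 1 and any nonzero column of
    [cokermx J] generates it. That column alone then detects the row space of [J]. *)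
Lemma cokernel_of_line (C : fieldType) n (J : 'M[C]_n) (x : 'rV[C]_n) :
  x != 0 -> x *m J = 0 -> (forall y : 'rV_n, y *m J = 0 -> exists c, y = c *: x) ->
  exists2 w : 'cV[C]_n, w != 0 &
    forall r : 'rV_n, r *m w = 0 -> exists y : 'rV_n, y *m J = r.
Proof.
move=> x0 xJ kerJ.
have rkx : \rank x = 1%N by apply/eqP; rewrite eqn_leq rank_leq_row lt0n mxrank_eq0.
have rk : \rank (cokermx J) = 1%N.
  have kx : (kermx J <= x)%MS.
    apply/row_subP => i; have [|c ->] := kerJ (row i (kermx J)).
      by rewrite -row_mul mulmx_ker row0.
    exact: scalemx_sub.
  have xk : (x <= kermx J)%MS by apply/sub_kermxP.
  rewrite mxrank_coker -mxrank_ker -rkx; apply/eqP.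
  by rewrite eqn_leq !mxrankS.
have [j wj] : exists j, col j (cokermx J) != 0.
  apply: contrapT => h; suff : cokermx J = 0 by move=> E; rewrite E mxrank0 in rk.
  apply/matrixP => i j; have : col j (cokermx J) = 0.
    by apply/eqP; apply: contrapT => /negP hj; apply: h; exists j.
  by move/colP/(_ i); rewrite !mxE.
exists (col j (cokermx J)) => // r rw.
have sub : ((col j (cokermx J))^T <= (cokermx J)^T)%MS by rewrite tr_col row_sub.
have rkw : \rank (col j (cokermx J))^T = 1%N.
  by apply/eqP; rewrite eqn_leq rank_leq_row lt0n mxrank_eq0 trmx_eq0.
have /submxP[D hD] : ((cokermx J)^T <= (col j (cokermx J))^T)%MS.
  by rewrite -(mxrank_leqif_sup sub) rkw mxrank_tr rk.
have /submxP[y ->] : (r <= J)%MS.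
  by rewrite submxE -[cokermx J]trmxK hD trmx_mul trmxK mulmxA rw mul0mx.
by exists y.
Qed.

(** * Order of vanishing of the resultant at a system with nondegenerate zeros *)

Section Multiplicity.
Variables (C : numClosedFieldType) (n d : nat) (Res : generic_coef_poly n d).
Hypotheses (d_gt0 : (0 < d)%N) (hRes : is_resultant C Res).
Variable F : 'I_n -> {mpoly C[n]}.
Hypothesis F_homog : forall i, F i \is d.-homog.

Let M := #|coef_index n d|.
Let P : {mpoly C[M]} := map_mpoly intr Res.

Lemma resultant_eq0 G : (forall i, G i \is d.-homog) -> (eval_coef Res G = 0 <->
  exists2 x : 'rV[C]_n, x != 0 & forall i, (G i).@[x 0] = 0).
Proof. by case: hRes => h _ _; apply: h. Qed.

(** The resultant re-expanded around [F]: its lowest form is the first nonzero Taylor term at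
    [F]. *)
Definition shifted_resultant : {mpoly C[M]} :=
  P \mPo [tuple (coefs_of d F i)%:MP + 'X_i | i < M].

Lemma meval_shifted_resultant v :
  shifted_resultant.@[v] = P.@[fun i => coefs_of d F i + v i].
Proof.
rewrite comp_mpoly_meval; apply: meval_eq => i.
by rewrite tnth_mktuple mevalD mevalC mevalXU.
Qed.

(** Shifting from [F] to the system of the [X_i ^ d] gives the value 1. *)
Lemma shifted_resultant_neq0 : shifted_resultant != 0.
Proof.
apply/eqP => Q0; case: hRes => _ h1 _; have := oner_neq0 C; rewrite -h1.
case/eqP; transitivity (shifted_resultant.@[fun i =>
    coefs_of d (fun i => 'X_i ^+ d : {mpoly C[n]}) i - coefs_of d F i]).
  by rewrite meval_shifted_resultant; apply: meval_eq => i; rewrite addrC subrK.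
by rewrite Q0 meval0.
Qed.

(* If (F + e g)(x + e y) = O(e^2), subtracting a multiple of X_a^d of order e^2
   makes x + e y an exact zero, so Res vanishes on a curve tangent to g at F. *)
Lemma tangent_vanishing e g (x y : 'rV[C]_n) (a : 'I_n) :
  (forall m, m \in msupp shifted_resultant -> (e <= mdeg m)%N) ->
  x 0 a != 0 -> y 0 a = 0 -> (forall i, (F i).@[x 0] = 0) ->
  (forall i, dirderiv x y (F i) + (form_of g i).@[x 0] = 0) ->
  (pihomog mdeg e shifted_resultant).@[g] = 0.
Proof.
move=> emin xa ya Fx hg.
(* [R i] is the polynomial in [t] obtained by evaluating [F + t g] at [x + t y]; its two lowest
   coefficients vanish, and [S i] is the quotient by [t ^ 2]. *)
pose R i : {poly C} := along x y (F i) + 'X * along x y (form_of g i).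
pose S i := drop_poly 2 (R i).
have RS i : R i = 'X^2 * S i.
  rewrite -[LHS](poly_take_drop 2) -/(S i) mulrC; apply/eqP.
  rewrite -subr_eq0 addrK; apply/eqP/polyP => l; rewrite coef_take_poly coef0.
  have [F0 F1] := along_coef01 x y (F i).
  have [G0 _] := along_coef01 x y (form_of g i).
  case: l => [|[|//]] /=; rewrite coefD coefXM /=.
    by rewrite F0 Fx addr0.
  by rewrite F1 G0.
have [mu muE] : exists mu : homog_monom n d, bmnm (val mu) = (U_(a) *+ d)%MM.
  by apply: homog_monom_ex; rewrite mdegMn mdeg1 mul1n.
(* The curve is [t * w(t)] with [w(0) = g]. Since [y 0 a = 0], the monomial [X_a ^ d] has the
   constant value [x 0 a ^+ d] along [x + t y], so this correction removes exactly [t ^ 2 * S]. *)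
pose w c : {poly C} := let u := enum_val c in
  (g c)%:P - (if u.2 == mu then (x 0 a ^- d) *: ('X * S u.1) else 0).
have [r Qr] := mmap_lowest_form w emin.
have w0 c : (w c).[0] = g c.
  rewrite /w hornerD hornerN hornerC; case: ifP => _; last by rewrite horner0 subr0.
  by rewrite hornerZ hornerM hornerX mul0r mulr0 subr0.
suff Q0 : mmap polyC (fun i => 'X * w i) shifted_resultant = 0.
  have /eqP := Qr; rewrite Q0 eq_sym mulf_eq0 (negPf (monic_neq0 (monicXn _ _))) /=.
  move/eqP/(congr1 (horner^~ 0)); rewrite hornerD hornerM hornerX mul0r addr0.
  by rewrite horner0 mmap_horner => <-; apply: meval_eq => c; rewrite w0.
apply: poly_horner_inj => t; rewrite horner0 mmap_horner meval_shifted_resultant.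
pose v c := coefs_of d F c + t * (w c).[t].
transitivity (eval_coef Res (form_of v)).
  apply: meval_eq => c; rewrite -[RHS]/(coefs_of d (form_of v) c) form_ofK.
  by rewrite hornerM hornerX.
apply/resultant_eq0; first by move=> i; apply: form_of_homog.
exists (x + t *: y).
  apply/eqP => /rowP/(_ a); rewrite !mxE ya mulr0 addr0 => /eqP.
  by rewrite (negPf xa).
move=> i; rewrite meval_form_of.
transitivity ((R i).[t] - t ^+ 2 * (S i).[t]); last first.
  by rewrite RS hornerM hornerXn subrr.
pose z : 'rV[C]_n := x + t *: y.
have zmu : mmap1 (z 0) (bmnm (val mu)) = x 0 a ^+ d.
  rewrite muE /mmap1 (bigD1 a) //= big1 => [|b ba].
    by rewrite mulr1 mulmnE mnm1E eqxx mul1n !mxE ya mulr0 addr0.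
  by rewrite mulmnE mnm1E eq_sym (negPf ba) mul0n expr0.
pose kappa := t ^+ 2 * (S i).[t] * x 0 a ^- d.
have vE m : v (enum_rank (i, m)) = coefs_of d F (enum_rank (i, m)) +
    t * g (enum_rank (i, m)) - (if m == mu then kappa else 0).
  rewrite /v /w enum_rankK /= hornerD hornerN hornerC mulrBr addrA.
  congr (_ - _); case: ifP => _; last by rewrite horner0 mulr0.
  by rewrite hornerZ hornerM hornerX /kappa; ring.
have -> : (R i).[t] = (form_of (coefs_of d F) i).@[z 0] + t * (form_of g i).@[z 0].
  by rewrite hornerD hornerM hornerX !horner_along coefs_ofK.
have -> : t ^+ 2 * (S i).[t] =
    \sum_m (if m == mu then kappa else 0) * mmap1 (z 0) (bmnm (val m)).
  rewrite (bigD1 mu) //= eqxx zmu divfK ?expf_neq0 // big1 ?addr0 // => m mmu.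
  by rewrite (negPf mmu) mul0r.
rewrite !meval_form_of mulr_sumr -big_split -sumrB; apply: eq_bigr => m _ /=.
by rewrite vE mulrBl mulrDl mulrA.
Qed.

(** Both inequalities pass through the degree [e] of the lowest form of the shifted resultant: it
    vanishes on [N] distinct hyperplanes, so [N <= e], and [phi] is its restriction to a line
    through the origin, so [e <= mup lambda phi]. *)
Theorem mup_ge_nondegenerate_zeros N (x : 'I_N -> 'rV[C]_n)
    (G : 'I_n -> {mpoly C[n]}) (phi : {poly C}) lambda :
  phi != 0 -> (forall i, G i \is d.-homog) ->
  (forall s, phi.[lambda + s] = eval_coef Res (fun i => F i + s *: G i)) ->
  (forall j, x j != 0) -> (forall j i, (F i).@[x j 0] = 0) ->
  (forall j y, (forall i, dirderiv (x j) y (F i) = 0) -> exists c, y = c *: x j) ->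
  (forall j l c, j != l -> x l != c *: x j) ->
  (N <= mup lambda phi)%N.
Proof.
move=> phi0 Gh phiE x0 Fx xker xne.
have [e [h0 emin]] := lowest_form shifted_resultant_neq0.
pose J j := \matrix_(b, i) ((F i)^`M(b)).@[x j 0].
have JE j (y : 'rV_n) i : (y *m J j) 0 i = dirderiv (x j) y (F i).
  by rewrite !mxE; apply: eq_bigr => b _; rewrite mxE.
have /choice[w hw] : forall j, exists w : 'cV[C]_n, w != 0 /\
    forall r : 'rV_n, r *m w = 0 -> exists y : 'rV_n, y *m J j = r.
  move=> j; have [|y yJ|w w0 hw] := @cokernel_of_line _ _ (J j) (x j) (x0 j).
  - by apply/rowP => i; rewrite JE mxE (euler_zero (F_homog i)).
  - by apply: xker => i; rewrite -JE yJ mxE.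
  by exists w.
pose a j := fun c : 'I_M => let u := enum_val c in
  w j u.1 0 * mmap1 (x j 0) (bmnm (val u.2)).
apply: (@leq_trans e).
  apply: (homog_vanishing_on_hyperplanes (a := a) h0 (pihomogP _ _ _)).
    move=> j g; rewrite /a meval_form_of_pairing => hg.
    have [|y yJ] := (hw j).2 (\row_i - (form_of g i).@[x j 0]).
      apply/rowP => i; rewrite (ord1 i) !mxE -[RHS]oppr0 -[in RHS]hg -sumrN.
      by apply: eq_bigr => l _; rewrite mxE mulNr mulrC.
    (* By Euler [x j] is in the kernel of [J j], so subtracting a multiple of it arranges that
       coordinate [b] of the direction is 0, as [tangent_vanishing] requires. *)
    have [b xb] := rV0Pn _ (x0 j).
    have yJ' i : dirderiv (x j) (y - (y 0 b / x j 0 b) *: x j) (F i) +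
        (form_of g i).@[x j 0] = 0.
      rewrite -JE mulmxBl -scalemxAl yJ !mxE.
      have -> : \sum_l x j 0 l * J j l i = 0.
        rewrite -[RHS](euler_zero (F_homog i) (Fx j i)).
        by apply: eq_bigr => l _; rewrite mxE.
      by rewrite mulr0 subr0 addNr.
    apply: (tangent_vanishing emin xb _ (Fx j) yJ').
    by rewrite !mxE divfK // subrr.
  move=> j l jl.
  have [i wi] : exists i, w l i 0 != 0 by apply/cV0Pn; case: (hw l).
  (* Non-proportional vectors have a nonzero 2 by 2 minor. *)
  have [[b c] /= hbc] : exists bc : 'I_n * 'I_n,
      x j 0 bc.1 * x l 0 bc.2 - x j 0 bc.2 * x l 0 bc.1 != 0.
    apply: contrapT => hbc; have [b xb] := rV0Pn _ (x0 j).
    case/eqP: (xne j l (x l 0 b / x j 0 b) jl); apply/rowP => c; rewrite mxE.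
    apply: (mulfI xb); transitivity (x l 0 b * x j 0 c); last by field.
    apply/eqP; rewrite -subr_eq0; apply: contraT => hc; exfalso; apply: hbc.
    by exists (b, c); rewrite /= [x j 0 c * _]mulrC.
  (* [L] vanishes at [x j] but not at [x l]. Placing [L ^+ d] in a row where [w l] is nonzero gives
     a system on the hyperplane of [x j] and off that of [x l]. *)
  pose L : {mpoly C[n]} := x j 0 b *: 'X_c - x j 0 c *: 'X_b.
  have Lh : L \is 1.-homog.
    by rewrite rpredB // rpredZ // dhomogX; apply/eqP/mdeg1.
  pose H i' : {mpoly C[n]} := if i' == i then L ^+ d else 0.
  have Hh i' : H i' \is d.-homog.
    rewrite /H; case: ifP => _; last exact: dhomog0.
    by have := dhomogMn d Lh; rewrite mul1n.
  have pairE m : pairing (a m) (coefs_of d H) = w m i 0 * L.@[x m 0] ^+ d.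
    rewrite /a meval_form_of_pairing (bigD1 i) //= big1 ?addr0.
      by rewrite coefs_ofK // /H eqxx rmorphXn.
    by move=> i' i'i; rewrite coefs_ofK // /H (negPf i'i) meval0 mulr0.
  have LE m : L.@[x m 0] = x j 0 b * x m 0 c - x j 0 c * x m 0 b.
    by rewrite mevalB !mevalZ !mevalXU.
  exists (coefs_of d H); rewrite !pairE !LE [x j 0 b * x j 0 c]mulrC subrr.
  by rewrite expr0n gtn_eqF // mulr0 mulf_neq0 // expf_neq0.
rewrite mup_geq //.
(* Along the line [F + s G] the curve is [s] times a constant vector, so [s ^ e] divides
   [phi(lambda + s)]. *)
have [r hr] := mmap_lowest_form (fun c => (coefs_of d G c)%:P) emin.
have phiE' : phi \Po ('X + lambda%:P) =
    mmap polyC (fun c => 'X * (coefs_of d G c)%:P) shifted_resultant.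
  apply: poly_horner_inj => s.
  rewrite horner_comp hornerD hornerX hornerC addrC phiE mmap_horner.
  rewrite meval_shifted_resultant; apply: meval_eq => c /=.
  by rewrite /coefs_of mcoeffD mcoeffZ hornerM hornerX hornerC.
have -> : phi = (phi \Po ('X + lambda%:P)) \Po ('X - lambda%:P).
  by rewrite -comp_polyA comp_polyD comp_polyX comp_polyC subrK comp_polyXr.
by rewrite phiE' hr comp_polyM rmorphXn /= comp_polyX dvdp_mulIl.
Qed.

End Multiplicity.

(** * Finite unions of lines *)

Section CharacteristicPolynomial.

Lemma meval_map_mpoly (R S : comNzRingType) n (f : {rmorphism R -> S})
    (v : 'I_n -> S) (p : {mpoly R[n]}) : (map_mpoly f p).@[v] = mmap f v p.
Proof.
rewrite /map_mpoly {1}/mmap meval_sum; apply: eq_bigr => m _.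
rewrite mevalM mevalC /mmap1 rmorph_prod; congr (_ * _).
by apply: eq_bigr => i _; rewrite rmorphXn /= mevalXU.
Qed.

(** The resultant has integer coefficients, which every ring morphism preserves; hence specializing
    the variable commutes with it. *)
Lemma rmorph_eval_coef (S S' : comNzRingType) (f : {rmorphism S -> S'}) n d
    (Res : generic_coef_poly n d) (F : 'I_n -> {mpoly S[n]}) :
  f (eval_coef Res F) = eval_coef Res (fun i => map_mpoly f (F i)).
Proof.
rewrite /eval_coef !meval_map_mpoly /mmap rmorph_sum; apply: eq_bigr => m _.
rewrite rmorphM rmorph_int /mmap1 rmorph_prod; congr (_ * _).
by apply: eq_bigr => j _; rewrite rmorphXn /= mcoeff_map_mpoly.
Qed.

Lemma horner_tensor_char_poly (C : numClosedFieldType) (k n : nat)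
    (Res : generic_coef_poly n k.-1) (A : tensor C k n) z :
  (tensor_char_poly Res A).[z] = eval_coef Res (eig_form A z).
Proof.
rewrite -[LHS]/(horner_eval z _) rmorph_eval_coef; congr eval_coef.
apply/funext => i; rewrite /char_form rmorphB; congr (_ - _).
  by rewrite /= map_mpolyZ rmorphXn /= map_mpolyX /horner_eval hornerX.
rewrite rmorph_sum; apply: eq_bigr => t _; rewrite /= map_mpolyZ rmorph_prod.
congr (_ *: _); first by rewrite /= /horner_eval hornerC.
by apply: eq_bigr => j _; apply: map_mpolyX.
Qed.

End CharacteristicPolynomial.

(** * Irreducibility and dimension of lines and their finite unions *)

Section Lines.
Variables (C : numClosedFieldType) (n : nat).
Implicit Types (V W Z L : set 'rV[C]_n) (x y : 'rV[C]_n).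

Definition line x : set 'rV[C]_n := [set y | exists c, y = c *: x].

Lemma zariski_closed0 : @zariski_closed C n set0.
Proof.
exists [set 1]; apply/seteqP; split=> // x /= /(_ 1 erefl).
by rewrite meval1 => /eqP; rewrite oner_eq0.
Qed.

Lemma zariski_closedU V W :
  zariski_closed V -> zariski_closed W -> zariski_closed (V `|` W).
Proof.
move=> [S ->] [T ->]; exists [set r | exists p q, [/\ S p, T q & r = p * q]].
apply/seteqP; split=> x /=.
  move=> [hS|hT] r [p [q [Sp Tq ->]]]; rewrite mevalM.
    by rewrite (hS p) // mul0r.
  by rewrite (hT q) // mulr0.
move=> h; apply: contrapT => /not_orP[hS hT].
have [p /not_implyP[Sp /eqP px]] : exists p, ~ (S p -> p.@[x 0] = 0) by apply/existsNP.
have [q /not_implyP[Tq /eqP qx]] : exists q, ~ (T q -> q.@[x 0] = 0) by apply/existsNP.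
have /eqP := h (p * q) (ex_intro _ p (ex_intro _ q (And3 Sp Tq erefl))).
by rewrite mevalM mulf_eq0 (negPf px) (negPf qx).
Qed.

Lemma irreducible_sub_union (I : eqType) (L : I -> set 'rV[C]_n) (s : seq I) W :
  irreducible_closed W -> (forall i, zariski_closed (L i)) ->
  W `<=` [set y | exists2 i, i \in s & L i y] -> exists2 i, i \in s & W `<=` L i.
Proof.
move=> [Wc [w0 Ww0] Wirr] Lc.
have Uc (r : seq I) : zariski_closed [set y | exists2 i, i \in r & L i y].
  elim: r => [|i r IH].
    rewrite (_ : [set y | _] = set0); first exact: zariski_closed0.
    by apply/seteqP; split=> // y [].
  rewrite (_ : [set y | _] = L i `|` [set y | exists2 i, i \in r & L i y]).
    exact: zariski_closedU.
  apply/seteqP; split=> y /=.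
    by move=> [l]; rewrite inE => /orP[/eqP -> ?|lr ?]; [left|right; exists l].
  by move=> [?|[l lr ?]]; [exists i; rewrite ?mem_head|exists l; rewrite ?inE ?lr ?orbT].
elim: s => [|i s IH] h; first by have [] := h _ Ww0.
have [|Wi|Ws] := Wirr _ _ (Lc i) (Uc s).
- move=> y /h[l]; rewrite inE => /orP[/eqP -> ?|lr ?]; [by left|by right; exists l].
- by exists i; rewrite ?mem_head.
by have [l ls Wl] := IH Ws; exists l; rewrite ?inE ?ls ?orbT.
Qed.

Lemma zariski_closed1 x : zariski_closed [set x].
Proof.
exists [set p | exists b, p = 'X_b - (x 0 b)%:MP]; apply/seteqP; split=> y /=.
  by move=> -> p [b ->]; rewrite mevalB mevalXU mevalC subrr.
move=> h; apply/rowP => b; have /eqP := h _ (ex_intro _ b erefl).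
by rewrite mevalB mevalXU mevalC subr_eq0 => /eqP.
Qed.

Lemma irreducible_closed1 x : irreducible_closed [set x].
Proof.
split; [exact: zariski_closed1|by exists x|].
move=> W Z _ _ h; case: (h x erefl) => ?; [left|right]; by move=> y ->.
Qed.

(** If neither closed set contains the line, each has an equation restricting to a nonzero
    polynomial in the parameter, and a nonroot of the product gives a point outside both. *)
Lemma irreducible_line x : x != 0 -> irreducible_closed (line x).
Proof.
move=> x0; split.
- have [a xa] := rV0Pn _ x0.
  exists [set p | exists b, p = x 0 a *: 'X_b - x 0 b *: 'X_a].
  apply/seteqP; split=> y /=.
    move=> [c ->] p [b ->]; rewrite mevalB !mevalZ !mevalXU !mxE; ring.
  move=> h; exists (y 0 a / x 0 a); apply/rowP => b.
  have /eqP := h _ (ex_intro _ b erefl).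
  rewrite mevalB !mevalZ !mevalXU subr_eq0 => /eqP hb.
  by apply: (mulfI xa); rewrite hb mxE; field.
- by exists x; exists 1; rewrite scale1r.
move=> W Z [S ->] [T ->] h; apply: contrapT => /not_orP[hW hZ].
have get U : ~ (line x `<=` [set y | forall p : {mpoly C[n]}, U p -> p.@[y 0] = 0]) ->
    exists p, U p /\ along 0 x p != 0.
  move=> hU; apply: contrapT => hp; apply: hU => _ [c ->] p Up.
  have : along 0 x p = 0.
    by apply/eqP; apply: contrapT => /negP ?; apply: hp; exists p.
  by move/(congr1 (horner^~ c)); rewrite horner0 horner_along add0r.
have [p [Sp p0]] := get _ hW; have [q [Tq q0]] := get _ hZ.
have [t] := poly_nonroot (mulf_neq0 p0 q0).
rewrite hornerM !horner_along add0r mulf_eq0.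
case: (h (t *: x)) => [|hS|hT]; first by exists t.
  by rewrite (hS p Sp) eqxx.
by rewrite (hT q Tq) eqxx orbT.
Qed.

(** Some equation of [Z] restricts to a nonzero polynomial on the line, so [Z] lies in the finite
    set given by its roots, and irreducibility selects one point. *)
Lemma irreducible_proper_sub_line Z x : irreducible_closed Z -> Z `<` line x ->
  exists y, Z = [set y].
Proof.
move=> Zirr [Zx xZ]; have [[S ZE] [z0 Zz0] _] := Zirr.
have [p [Sp p0]] : exists p, S p /\ along 0 x p != 0.
  apply: contrapT => hp; apply: xZ => _ [c ->]; rewrite ZE => p Sp.
  have : along 0 x p = 0.
    by apply/eqP; apply: contrapT => /negP ?; apply: hp; exists p.
  by move/(congr1 (horner^~ c)); rewrite horner0 horner_along add0r.
have [r pE] := closed_field_poly_normal (along 0 x p).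
have [||t _ Zt] := @irreducible_sub_union _ (fun t => [set t *: x]) r Z Zirr.
- by move=> t; apply: zariski_closed1.
- move=> y Zy; have [c yE] := Zx y Zy; exists c => //.
  rewrite -root_prod_XsubC -(rootZ _ _ (_ : lead_coef (along 0 x p) != 0)).
    by rewrite -pE rootE horner_along add0r -yE; move: Zy; rewrite ZE => /(_ p Sp) ->.
  by rewrite lead_coef_eq0.
exists (t *: x); apply/seteqP; split=> // y ->.
by rewrite -(Zt _ Zz0).
Qed.

Lemma has_chain_line V x : x != 0 -> line x `<=` V -> has_chain V 1.
Proof.
move=> x0 xV; exists (fun i => if i is 0 then [set 0] else line x); split.
  case=> [|[|//]] _; split=> //.
  - exact: irreducible_closed1.
  - by move=> _ ->; apply: xV; exists 0; rewrite scale0r.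
  exact: irreducible_line.
case=> // _; split; first by move=> _ ->; exists 0; rewrite scale0r.
move/(_ x) => h; case/eqP: x0; apply: h.
by exists 1; rewrite scale1r.
Qed.

(** In a longer chain the top set lies in one line, so the set below it is a point, which leaves no
    room for a smaller nonempty set. *)
Lemma has_chain_union_of_lines (I : eqType) (x : I -> 'rV[C]_n) (s : seq I) V e :
  (forall i, x i != 0) ->
  V `<=` [set y | exists2 i, i \in s & line (x i) y] -> has_chain V e -> (e <= 1)%N.
Proof.
move=> x0 Vs [Z [Zirr Zlt]]; rewrite leqNgt; apply/negP.
case: e Zirr Zlt => [|[|e]] // Zirr Zlt _.
have [i _ Zi] : exists2 i, i \in s & Z e.+2 `<=` line (x i).
  have [Z2 Z2V] := Zirr e.+2 (leqnn _).
  apply: irreducible_sub_union => //; first by move=> i; case: (irreducible_line (x0 i)).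
  exact: subset_trans Vs.
have lt1 : Z e.+1 `<` line (x i).
  have [Z12 Z21] := Zlt e.+1 (ltnSn _).
  split; first exact: subset_trans Zi.
  by move=> hi; apply: Z21; apply: subset_trans hi.
have [y Zy] := irreducible_proper_sub_line (Zirr e.+1 (leqnSn _)).1 lt1.
have [Z01 Z10] := Zlt e (leqnSn _).
have [[_ [z Zz] _] _] := Zirr e (leq_trans (leqnSn _) (leqnSn _)).
apply: Z10; rewrite Zy => _ ->.
by have := Z01 _ Zz; rewrite Zy => <-.
Qed.

Lemma zdim_eq V d : has_chain V d -> (forall e, has_chain V e -> (e <= d)%N) ->
  zdim V = d.
Proof.
move=> Vd dmax; apply: xget_unique => // e [Ve emax].
by apply/eqP; rewrite eqn_leq dmax // emax.
Qed.

Lemma zdim_union_of_lines (I : eqType) (x : I -> 'rV[C]_n) (s : seq I) V i :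
  (forall i, x i != 0) -> V `<=` [set y | exists2 i, i \in s & line (x i) y] ->
  line (x i) `<=` V -> zdim V = 1%N.
Proof.
move=> x0 Vs xV; apply: zdim_eq; first exact: has_chain_line xV.
by move=> e; apply: has_chain_union_of_lines Vs.
Qed.

End Lines.

(** The bound allows a maximal family of pairwise non-proportional points; a vector of [V] on none
    of their lines would extend it. *)
Lemma line_representatives (C : numClosedFieldType) n (V : set 'rV[C]_n) m :
  (forall N (x : 'I_N -> 'rV[C]_n), (forall j, x j != 0) -> (forall j, V (x j)) ->
     (forall j l c, j != l -> x l != c *: x j) -> (N <= m)%N) ->
  (exists2 x, x != 0 & V x) ->
  exists N (x : 'I_N -> 'rV[C]_n), [/\ (0 < N <= m)%N, forall j, x j != 0,
    forall j, V (x j) & forall y, V y -> exists j, line (x j) y].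
Proof.
move=> bound [x0 x0_neq0 Vx0].
pose family N (x : 'I_N -> 'rV[C]_n) := [/\ forall j, x j != 0, forall j, V (x j)
  & forall j l c, j != l -> x l != c *: x j].
have ex1 : exists N, `[< exists x, @family N x >].
  exists 1%N; apply/asboolP; exists (fun=> x0); split=> // j l c.
  by rewrite !ord1.
have le_m N : `[< exists x, @family N x >] -> (N <= m)%N.
  by move/asboolP => [x [? ? ?]]; apply: (bound _ x).
case: (ex_maxnP ex1 le_m) => N /asboolP[x [xn0 xV xne]] Nmax.
have N0 : (0 < N)%N.
  apply: Nmax; apply/asboolP; exists (fun=> x0); split=> // j l c.
  by rewrite !ord1.
exists N, x; split=> //.
  by rewrite N0 /=; apply: le_m; apply/asboolP; exists x.
move=> y Vy; have [->|y0] := eqVneq y 0.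
  by exists (Ordinal N0); exists 0; rewrite scale0r.
apply: contrapT => hy.
have hy' j c : y != c *: x j by apply/eqP => yE; apply: hy; exists j, c.
suff : (N.+1 <= N)%N by rewrite ltnn.
apply: Nmax; apply/asboolP.
exists (fun i => if unlift ord_max i is Some j then x j else y).
split=> [i|i|i l c].
- by case: unliftP.
- by case: unliftP.
case: (unliftP ord_max i) => [j ->|->]; case: (unliftP ord_max l) => [j' ->|->] //.
- by rewrite (inj_eq lift_inj); apply: xne.
- move=> _; apply/eqP => xE; have c0 : c != 0.
    by apply: contra_neq (xn0 j') => c0; rewrite xE c0 scale0r.
  by have /eqP := hy' j' c^-1; rewrite xE scalerA mulVf // scale1r.
by rewrite eqxx.
Qed.

Theorem theorem1p3 (R : realType) (k n : nat) (hk : (2 <= k)%N)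
    (Res : generic_coef_poly n k.-1) (hRes : is_resultant R[i] Res)
    (A : tensor R[i] k n)
    (hnonneg : nonneg_tensor A) (hirr : weakly_irreducible A)
    (rho : R[i]) (hrho : is_spectral_radius Res A rho)
    (lambda : R[i]) (hlambda : eigenvalue_of A lambda)
    (hmod : `|lambda| = rho) :
  [/\ (projective_eigenvariety A lambda #<= `I_(alg_mult Res A lambda))%card,
      forall (kappa : nat) (V : 'I_kappa -> set 'rV[R[i]]_n),
        injective V ->
        (forall W, irreducible_component (affine_eigenvariety A lambda) W <->
                   exists i, V i = W) ->
        (\sum_(i < kappa) zdim (V i) * (k - 1) ^ (zdim (V i) - 1)
           <= alg_mult Res A lambda)%N
    & (geom_mult A lambda * (k - 1) ^ (geom_mult A lambda - 1)
         <= alg_mult Res A lambda)%N].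
Proof.
have d0 : (0 < k.-1)%N by rewrite -subn1 subn_gt0.
have n0 : (0 < n)%N.
  have [x x0 _] := hlambda; have [i _] := rV0Pn _ x0.
  exact: leq_ltn_trans (ltn_ord i).
have rootE z : root (tensor_char_poly Res A) z <-> eigenvalue_of A z.
  rewrite rootE horner_tensor_char_poly; split.
    move/eqP/(resultant_eq0 hRes (eig_form_homog A z)) => [x x0 hx].
    by exists x => //; apply/affine_eigenvarietyP.
  move=> [x x0 /affine_eigenvarietyP hx]; apply/eqP.
  by apply/(resultant_eq0 hRes (eig_form_homog A z)); exists x.
have [r [r0 r_eig] hr] := eigenvectors_of_maximal_modulus n0 hnonneg hirr.
have [[z z_root z_rho] rho_max] := hrho.
(* The Perron eigenvalue [r] is a root, so [r <= rho]; a root of modulus [rho] is an eigenvalue, so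
   [rho <= r]. *)
have rho_r : rho = r.
  apply/le_anti/andP; split; last by rewrite -(ger0_norm r0) rho_max //; apply/rootE.
  by have /rootE[x x0 xz] := z_root; rewrite -z_rho; case: (hr z x x0 xz).
(* If the polynomial were zero, [rho + 1] would be a root exceeding the spectral radius. *)
have phi0 : tensor_char_poly Res A != 0.
  apply: contraTneq (lexx rho) => phi0.
  have rho0 : 0 <= rho by rewrite -z_rho normr_ge0.
  have := rho_max (rho + 1); rewrite phi0 root0 => /(_ isT).
  by rewrite ger0_norm ?addr_ge0 // gerDl ler10.
have hE := eig_form_homog A lambda.
pose V := affine_eigenvariety A lambda.
(* Moving the eigenvalue from [lambda] to [lambda + s] adds [s * X_i ^ (k-1)] to each form, which is
   the direction [G]. *)
have bound N (x : 'I_N -> 'rV[R[i]]_n) : (forall j, x j != 0) -> (forall j, V (x j)) ->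
    (forall j l c, j != l -> x l != c *: x j) -> (N <= alg_mult Res A lambda)%N.
  move=> x0 xV xne.
  apply: (mup_ge_nondegenerate_zeros d0 hRes hE
    (G := fun i => 'X_i ^+ k.-1) (x := x)) => //.
  - move=> i; have := dhomogMn k.-1 (_ : 'X_i \is 1.-homog).
    by rewrite mul1n; apply; rewrite dhomogX; apply/eqP/mdeg1.
  - move=> s; rewrite horner_tensor_char_poly; congr eval_coef; apply/funext => i.
    by rewrite /eig_form scalerDl addrAC.
  - by move=> j; apply/affine_eigenvarietyP; apply: xV.
  by move=> j; have [_ []] := hr lambda (x j) (x0 j) (xV j); rewrite ?hmod.
have [N [x [/andP[N0 Nm] x0 xV cover]]] := line_representatives bound hlambda.
have lineV j : line (x j) `<=` V.
  move=> _ [c ->]; apply/affine_eigenvarietyP => i.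
  by rewrite (meval_homogZ _ _ (hE i)) ((affine_eigenvarietyP _ _ _).1 (xV j)) mulr0.
have subV W : W `<=` V -> W `<=` [set y | exists2 j, j \in enum 'I_N & line (x j) y].
  by move=> WV y /WV/cover[j ?]; exists j; rewrite ?mem_enum.
have zdimV : zdim V = 1%N.
  exact: (zdim_union_of_lines x0 (subV V _) (lineV (Ordinal N0))).
split.
(* Every projective point is spanned by some [x j]; the zero space is only a default for indices out
   of range. *)
- pose f m : {vspace 'rV[R[i]]_n} := if insub m is Some j then <[x j]>%VS else 0%VS.
  apply: (@card_le_trans _ _ _ (f @` `I_N)).
    apply: subset_card_le => L [/= dimL LV].
    have [y yL y0] : exists2 y, y \in L & y != 0.
      exists (vpick L); first exact: memv_pick.
      by rewrite vpick0 -dimv_eq0 dimL.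
    have [j [c yE]] := cover y (LV y yL).
    exists j => //=; rewrite /f valK; apply/eqP; rewrite eqEdim dimL dim_vline x0 /=.
    have c0 : c != 0 by apply: contra_neq y0 => c0; rewrite yE c0 scale0r.
    rewrite andbT -memvE (_ : x j = c^-1 *: y) ?memvZ //.
    by rewrite yE scalerA mulVf // scale1r.
  by apply: (card_le_trans (card_image_le _ _)); rewrite card_le_II.
(* A component lies in one line by irreducibility and equals it by maximality. So the components
   inject into the [N] lines, and each contributes [1 * (k - 1) ^ 0 = 1] to the sum. *)
- move=> kappa W Winj WP.
  have /choice[f fE] : forall i, exists j, W i = line (x j).
    move=> i; have [Wirr WV Wmax] := (WP (W i)).2 (ex_intro _ i erefl).
    have [j|j _ Wj] := irreducible_sub_union Wirr _ (subV _ WV).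
      by case: (irreducible_line (x0 j)).
    exists j; by apply/esym/Wmax => //; apply: irreducible_line.
  have f_inj : injective f by move=> i j fij; apply: Winj; rewrite !fE fij.
  have kappaN : (kappa <= N)%N by have := leq_card f f_inj; rewrite !card_ord.
  rewrite (eq_bigr (fun=> 1%N)) => [|i _].
    by rewrite sum1_card card_ord (leq_trans kappaN).
  rewrite fE (@zdim_union_of_lines _ _ _ x [:: f i] _ (f i)) //.
  by move=> y hy; exists (f i); rewrite ?mem_head.
by rewrite /geom_mult zdimV subnn expn0 muln1; apply: leq_trans Nm.
Qed.
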